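(* Let $n\ge 1$ and let $\mathbf{X}=(X_1,\dots,X_n)^T\sim E_n(\boldsymbol\mu,\mathbf\Sigma,g_n)$ be an elliptical random vector with density generator $g_n$, positive definite scale matrix $\mathbf\Sigma=(\sigma_{ij})_{i,j=1}^n$ and finite expectation $\boldsymbol\mu=(\mu_1,\dots,\mu_n)^T$. Let $\mathbf{X}^{*}\sim E_n(\boldsymbol\mu,\mathbf\Sigma,\overline G_n)$ and $\mathbf{X}^{**}\sim E_n(\boldsymbol\mu,\mathbf\Sigma,\overline{\mathcal G}_n)$. Let $\mathbf A$ be the lower triangular Cholesky factor of $\mathbf\Sigma$. Let $f:\mathbb R^n\to\mathbb R$ be twice continuously differentiable such that the expectations $E[\nabla_{i,j}f(\mathbf X^{**})]$ and $E[\nabla_i f(\mathbf X^{*})]$ are finite for all $i,j=1,\dots,n$. Assume in addition that (for all values of the remaining coordinates $x_2,\dots,x_n$ of $\boldsymbol x$) $$\lim_{|x_1|\to\infty}x_1 f(\mathbf A\boldsymbol x+\boldsymbol\mu)\,\overline G_n\!\left(\tfrac12\boldsymbol x^T\boldsymbol x\right)=0$$ and $$\lim_{|x_1|\to\infty}\left[\frac{\partial}{\partial x_1}\bigl(f(\mathbf A\boldsymbol x+\boldsymbol\mu)\bigr)\right]\overline{\mathcal G}_n\!\left(\tfrac12\boldsymbol x^T\boldsymbol x\right)=0 .$$ Then $$E[X_1^2f(\mathbf X)]=\sigma_{11}b_n^{*}E[f(\mathbf X^{*})]+b_n^{**}\sum_{i=1}^n\sum_{j=1}^n\sigma_{i1}\sigma_{j1}E[\nabla_{i,j}f(\mathbf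 X^{**})]+2\mu_1b_n^{*}\sum_{i=1}^n\sigma_{i1}E[\nabla_if(\mathbf X^{*})]+\mu_1^2E[f(\mathbf X)],$$ where $b_n^{*}=c_n/c_n^{*}$ and $b_n^{**}=c_n/c_n^{**}$.
   Context: Elliptical distributions with density: for $\boldsymbol\mu\in\mathbb R^n$, a positive definite $n\times n$ matrix $\mathbf\Sigma$, and a nonnegative function $g_n$ on $[0,\infty)$ with $0<\int_0^\infty t^{n/2-1}g_n(t)\,dt<\infty$ (the density generator), $\mathbf X\sim E_n(\boldsymbol\mu,\mathbf\Sigma,g_n)$ means that $\mathbf X$ has density $$f_{\mathbf X}(\boldsymbol x)=\frac{c_n}{\sqrt{|\mathbf\Sigma|}}\,g_n\!\left(\tfrac12(\boldsymbol x-\boldsymbol\mu)^T\mathbf\Sigma^{-1}(\boldsymbol x-\boldsymbol\mu)\right),\quad \boldsymbol x\in\mathbb R^n,\qquad c_n=\frac{\Gamma(n/2)}{(2\pi)^{n/2}}\left[\int_0^\infty t^{n/2-1}g_n(t)\,dt\right]^{-1}.$$ The cumulative generators are $\overline G_n(u)=\int_u^\infty g_n(v)\,dv$ and $\overline{\mathcal G}_n(u)=\int_u^\infty\overline G_n(v)\,dv$, with normalizing constants $$c_n^{*}=\frac{\Gamma(n/2)}{(2\pi)^{n/2}}\left[\int_0^\infty t^{n/2-1}\overline G_n(t)\,dt\right]^{-1},\qquad c_n^{**}=\frac{\Gamma(n/2)}{(2\pi)^{n/2}}\left[\int_0^\infty t^{n/2-1}\overline{\mathcal G}_n(t)\,dt\right]^{-1}.$$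 $\overline G_n$ and $\overline{\mathcal G}_n$ are understood to be density generators themselves (the two integrals are finite), so $E_n(\boldsymbol\mu,\mathbf\Sigma,\overline G_n)$ and $E_n(\boldsymbol\mu,\mathbf\Sigma,\overline{\mathcal G}_n)$ are defined by the same density formula with $(g_n,c_n)$ replaced by $(\overline G_n,c_n^{*})$ and $(\overline{\mathcal G}_n,c_n^{**})$. The Cholesky factor $\mathbf A$ is the unique lower triangular matrix with positive diagonal entries such that $\mathbf A\mathbf A^T=\mathbf\Sigma$. Notation: $\nabla_if(\boldsymbol x)=\partial f(\boldsymbol x)/\partial x_i$, $\nabla_{i,j}f(\boldsymbol x)=\partial^2f(\boldsymbol x)/\partial x_i\partial x_j$. *)

(* Defs.v *)
(* Vectors of R^n are column matrices 'cV[R]_n. *)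
From HB Require Import structures.
From mathcomp Require Import all_boot all_order all_algebra.
From mathcomp Require Import all_classical all_reals all_analysis.

Set Implicit Arguments.
Unset Strict Implicit.
Unset Printing Implicit Defensive.

Import Order.TTheory GRing.Theory Num.Theory.
Import numFieldNormedType.Exports.

Local Open Scope classical_set_scope.
Local Open Scope ring_scope.

Definition measure_matrix_display : measure_display -> measure_display.
Proof. exact. Qed.

Section measurable_matrix.
Context {d} {T : sigmaRingType d}.
Variables m n : nat.

(* The product sigma-algebra, generated by the entries; over R it is the Borel
   sigma-algebra of R^(m * n). *)
Definition mx_sigma_algebra : set (set 'M[T]_(m, n)) :=
  <<s \bigcup_(ij in [set: 'I_m * 'I_n])
        preimage_set_system setT (fun M : 'M[T]_(m, n) => M ij.1 ij.2)
          measurable >>.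

Let mx_set0 : mx_sigma_algebra set0.
Proof. exact: sigma_algebra0. Qed.

Let mx_setC A : mx_sigma_algebra A -> mx_sigma_algebra (~` A).
Proof. exact: sigma_algebraC. Qed.

Let mx_bigcup (F : (set _)^nat) :
  (forall i, mx_sigma_algebra (F i)) -> mx_sigma_algebra (\bigcup_i (F i)).
Proof. exact: sigma_algebra_bigcup. Qed.

HB.instance Definition _ := @isMeasurable.Build (measure_matrix_display d)
  'M[T]_(m, n) mx_sigma_algebra mx_set0 mx_setC mx_bigcup.

End measurable_matrix.

Lemma measurable_entry d (T : sigmaRingType d) m n (i : 'I_m) (j : 'I_n) :
  measurable_fun [set: 'M[T]_(m, n)] (fun M : 'M[T]_(m, n) => M i j).
Proof.
move=> _ Y mY; rewrite setTI; apply: sub_sigma_algebra.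
by exists (i, j) => //; exists Y => //; rewrite setTI.
Qed.

Lemma measurable_fun_mxP d d' (T : sigmaRingType d) (S : measurableType d')
    m n (f : S -> 'M[T]_(m, n)) :
  (forall i j, measurable_fun [set: S] (fun x => f x i j)) ->
  measurable_fun [set: S] f.
Proof.
move=> mf _ Y; rewrite setTI.
suff : <<s \bigcup_(ij in [set: 'I_m * 'I_n])
        preimage_set_system setT (fun M : 'M[T]_(m, n) => M ij.1 ij.2)
          measurable >> `<=` [set Y | measurable (f @^-1` Y)].
  by move=> h; exact: h.
apply: smallest_sub.
  split => /=.
  - by rewrite preimage_set0.
  - move=> A; rewrite /= setTD => mA; exact: measurableC.
  - move=> F mF; rewrite /= preimage_bigcup; exact: bigcupT_measurable.
move=> _ [[i j] _ [B mB <-]] /=.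
by have := mf i j measurableT B mB; rewrite !setTI.
Qed.

Section lebesgue_Rn.
Context {R : realType}.

Definition cV_cons n (p : measurableTypeR R * 'cV[R]_n) : 'cV[R]_n.+1 :=
  col_mx (p.1%:M : 'M[R]_1) p.2.

Definition cV_uncons n (x : 'cV[R]_n.+1) : measurableTypeR R * 'cV[R]_n :=
  (x ord0 ord0, dsubmx (x : 'cV[R]_(1 + n))).

Lemma cV_consK n : cancel (@cV_cons n) (@cV_uncons n).
Proof.
move=> [x y]; congr pair; last exact: col_mxKd.
rewrite /cV_cons.
have -> : (ord0 : 'I_n.+1) = lshift n (ord0 : 'I_1) by exact/val_inj.
by rewrite (@col_mxEu _ 1%N n 1%N) mxE eqxx mulr1n.
Qed.

Lemma measurable_cV_cons n : measurable_fun setT (@cV_cons n).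
Proof.
apply: measurable_fun_mxP => i j.
rewrite -(splitK (i : 'I_(1 + n))); case: (fintype.split _) => k /=.
- rewrite (_ : (fun _ => _) = fst)//.
  apply/funext => p; rewrite (@col_mxEu _ 1%N n 1%N) mxE.
  by rewrite (ord1 k) (ord1 j) eqxx mulr1n.
- rewrite (_ : (fun _ => _) = (fun x : 'cV[R]_n => x k j) \o snd); last first.
    by apply/funext => p; rewrite (@col_mxEd _ 1%N n 1%N).
  by apply: measurableT_comp => //; exact: measurable_entry.
Qed.

Lemma measurable_cV_uncons n : measurable_fun setT (@cV_uncons n).
Proof.
apply/measurable_fun_pairP; split; first exact: measurable_entry.
apply: measurable_fun_mxP => i j.
rewrite (_ : (fun _ => _) = fun x : 'cV[R]_n.+1 => x (rshift 1 i) j).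
  exact: measurable_entry.
by apply/funext => x /=; rewrite mxE.
Qed.

Lemma cV_unconsK n : cancel (@cV_uncons n) (@cV_cons n).
Proof.
move=> x; apply: etrans (@vsubmxK _ 1 n 1 x); rewrite /cV_cons /cV_uncons /=.
congr (@col_mx R 1 n 1 _ _).
apply/matrixP => i j; rewrite !mxE (ord1 i) (ord1 j) eqxx mulr1n.
by congr (x _ _); exact/val_inj.
Qed.

Section step.
Variables (n : nat) (mu : {sigma_finite_measure set 'cV[R]_n -> \bar R}).

Let lam : {sigma_finite_measure set (measurableTypeR R) -> \bar R} := @lebesgue_measure R.

Definition lebesgue_step : set 'cV[R]_n.+1 -> \bar R :=
  pushforward (lam \x mu)%E (@cV_cons n).

Let step0 : lebesgue_step set0 = 0%E.
Proof. by rewrite /lebesgue_step /pushforward preimage_set0 measure0. Qed.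

Let step_ge0 A : (0 <= lebesgue_step A)%E.
Proof. by rewrite /lebesgue_step /pushforward measure_ge0. Qed.

Let step_sigma_additive : semi_sigma_additive lebesgue_step.
Proof.
move=> F mF tF mUF; rewrite /lebesgue_step /pushforward preimage_bigcup.
have mpre B : measurable B -> measurable (@cV_cons n @^-1` B).
  by move=> mB; rewrite -[X in measurable X]setTI; exact: measurable_cV_cons.
apply: measure_semi_sigma_additive.
- by move=> k; exact: mpre.
- apply/trivIsetP => /= i j _ _ ij; rewrite -preimage_setI.
  by move/trivIsetP : tF => /(_ _ _ _ _ ij) ->//; rewrite preimage_set0.
- by rewrite -preimage_bigcup; exact: mpre.
Qed.

HB.instance Definition _ := isMeasure.Build _ _ _
  lebesgue_step step0 step_ge0 step_sigma_additive.

Let step_sigma_finite : sigma_finite setT lebesgue_step.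
Proof.
have /sigma_finiteP[F [TF ndF Foo]] := sigma_finiteT lam.
have /sigma_finiteP[G [TG ndG Goo]] := sigma_finiteT mu.
exists (fun k => @cV_uncons n @^-1` (F k `*` G k)).
  rewrite -preimage_bigcup (_ : \bigcup_i _ = setT) ?preimage_setT//.
  rewrite -subTset => -[x y] _.
  have [i _ Fix] : (\bigcup_i F i) x by rewrite -TF.
  have [j _ Gjy] : (\bigcup_i G i) y by rewrite -TG.
  exists (maxn i j) => //; split => /=.
  - by move: x Fix; exact/subsetPset/ndF/leq_maxl.
  - by move: y Gjy; exact/subsetPset/ndG/leq_maxr.
move=> k; have [mF Fk] := Foo k; have [mG Gk] := Goo k; split.
  rewrite -[X in measurable X]setTI.
  by apply: measurable_cV_uncons => //; exact: measurableX.
rewrite /lebesgue_step /pushforward (_ : _ @^-1` _ = F k `*` G k).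
  by rewrite product_measure1E// lte_mul_pinfty// ge0_fin_numE.
by apply/funext => x; rewrite /preimage /mkset cV_consK.
Qed.

HB.instance Definition _ := @Measure_isSigmaFinite.Build _ _ _
  lebesgue_step step_sigma_finite.

End step.

(* n-fold product of one-dimensional Lebesgue measures. *)
Fixpoint lebesgue_cV n : {sigma_finite_measure set 'cV[R]_n -> \bar R} :=
  if n is m.+1 then lebesgue_step (lebesgue_cV m) else \d_(0 : 'cV[R]_0).

End lebesgue_Rn.

Section elliptical.
Context {R : realType}.
Implicit Types (g : R -> R) (n : nat).

Local Notation leb := (@lebesgue_measure R).

Definition Gamma_fun (s : R) : R :=
  \int[leb]_(t in `[0, +oo[) (t `^ (s - 1) * expR (- t)).

Definition generator_mass n g : \bar R :=
  (\int[leb]_(t in `[0%R, +oo[) (t `^ (n%:R / 2 - 1) * g t)%:E)%E.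

Definition density_generator n g : Prop :=
  [/\ measurable_fun (`[0, +oo[ : set R) g,
      forall t, 0 <= t -> 0 <= g t &
      (0 < generator_mass n g < +oo)%E].

Definition normalizing_constant n g : R :=
  Gamma_fun (n%:R / 2) / (2 * pi) `^ (n%:R / 2) / fine (generator_mass n g).

(* When the integral is infinite the value is 0.  If [g] and
   [cumulative_generator g] are density generators, this can only happen at
   u = 0, a value that affects no integral below. *)
Definition cumulative_generator g (u : R) : R :=
  \int[leb]_(v in `[u, +oo[) g v.

Definition posdef n (S : 'M[R]_n) : Prop :=
  S^T = S /\ forall x : 'cV[R]_n, x != 0 -> 0 < (x^T *m S *m x) ord0 ord0.

(* [is_trig_mx] is lower triangularity. *)
Definition cholesky_factor n (S A : 'M[R]_n) : Prop :=
  [/\ is_trig_mx A, forall i, 0 < A i i & A *m A^T = S].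

Definition elliptical_pdf n (mu : 'cV[R]_n) (S : 'M[R]_n) g (x : 'cV[R]_n) : R :=
  normalizing_constant n g / Num.sqrt (\det S) *
  g (2^-1 * ((x - mu)^T *m invmx S *m (x - mu)) ord0 ord0).

Definition elliptical d (T : measurableType d) (P : probability T R) n
    (X : {RV P >-> 'cV[R]_n}) (mu : 'cV[R]_n) (S : 'M[R]_n) g : Prop :=
  forall B : set 'cV[R]_n, measurable B ->
    distribution P X B =
    (\int[lebesgue_cV n]_(x in B) (elliptical_pdf mu S g x)%:E)%E.

Definition partial n (i : 'I_n) (f : 'cV[R]_n -> R) (x : 'cV[R]_n) : R :=
  'D_(delta_mx i ord0) f x.

Definition C1 n (f : 'cV[R]_n -> R) : Prop :=
  forall i : 'I_n, (forall x, derivable f x (delta_mx i ord0)) /\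
    continuous (partial i f).

Definition C2 n (f : 'cV[R]_n -> R) : Prop :=
  C1 f /\ forall i : 'I_n, C1 (partial i f).

Definition set_first n (x : 'cV[R]_n.+1) (t : R) : 'cV[R]_n.+1 :=
  \col_i (if i == ord0 then t else x i ord0).

(* h(x) --> 0 as |x_1| --> oo, the other coordinates of x being fixed *)
Definition vanishes_first n (h : 'cV[R]_n.+1 -> R) : Prop :=
  forall x, (h (set_first x t) @[t --> +oo] --> 0) /\
            (h (set_first x t) @[t --> -oo] --> 0).

End elliptical.

(* Main.v *)
From HB Require Import structures.
Require Import Defs.
From mathcomp Require Import all_boot all_order all_algebra.
From mathcomp Require Import all_classical all_reals all_analysis.
From mathcomp Require Import measurable_realfun ring lra.

Set Implicit Arguments.
Unset Strict Implicit.
Unset Printing Implicit Defensive.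

Import Order.TTheory GRing.Theory Num.Theory.
Import numFieldNormedType.Exports.

Local Open Scope classical_set_scope.
Local Open Scope ring_scope.

(** The identity is a spherical one in disguise.  Write [x = A z + mu] and
    [F z = f (A z + mu)].  Since [A A^T] is the scale matrix, the density of X
    becomes [c * g (|z|^2 / 2)] with respect to dz, and likewise for the two
    other vectors ([expectation_elliptical]).  As [A] is lower triangular, X_1 is
    [a * z_1 + mu_1] with [a = A_11], so that E[X_1^2 f(X)] is [c] times
<<
      a^2 int z_1^2 F g + 2 a mu_1 int z_1 F g + mu_1^2 int F g .
>>
    Let G be the tail integral of g and GG that of G.  Along the first axis
    [G (|z|^2 / 2)] is formally a primitive of [- z_1 g (|z|^2 / 2)]; integration by
    parts gives
<<
      int z_1 F g   = int (d_1 F) G                        [spherical_moment1]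
      int z_1^2 F g = int (F + z_1 d_1 F) G
                    = int F G + int (d_1^2 F) GG           [spherical_moment2]
>>
    and the chain rule together with [Sigma_i1 = a * A_i1] turns d_1 F and d_1^2 F
    into the sums of the theorem.  The ratios [c / c*] and [c / c**] convert the
    integrals against G and GG into expectations.

    Since g is only measurable, [G (t^2 / 2 + r)] need not be differentiable in
    [t].  Integration by parts is therefore an instance of Fubini's theorem: an
    increment of the smooth factor is the integral of its derivative, and the
    order of integration is exchanged ([half_line_by_parts], [line_by_parts],
    [space_by_parts]).  What it requires of g is
<<
      int_{t >= s} t g (t^2 / 2 + r) dt = G (s^2 / 2 + r) ,
>>
    a quadratic substitution for measurable integrands, which follows from the
    uniqueness of Lebesgue measure ([ge0_integral_quadratic]).

    Fubini's theorem needs absolute integrability of F g, z_1 F g and z_1^2 F g,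
    and it has to come from that of F G and of the second derivatives times GG.
    It comes from one-dimensional inequalities on a half-line: with w and W
    the tails of t v(t) and of t w(t),
<<
      t phi(t)    = int_0^t (phi + s phi')      so
      int t^2 v |phi| <= int (|phi| + s |phi'|) w             [half_line_bound1]
      t^3 phi'(t) = 3 t^2 phi(t) + int_0^t (s^3 phi'' - 6 s phi)      so
      int t w |phi'|  <= int (9 |phi| w + |phi''| W)          [half_line_bound2]
>>
    Applied on every line parallel to every axis, they bound z_i^2 F g for each
    [i], which controls F g away from the origin, while F is bounded near it
    ([spherical_integrable]). *)

(** * Differential calculus on R^n from continuous partial derivatives *)

Section calculus.
Context {R : realType}.

Let cvgD_continuous : continuous (fun z : R * R => z.1 + z.2).
Proof. by move=> z; apply: cvgD; [exact: cvg_fst|exact: cvg_snd]. Qed.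

Lemma is_derive_line (V : normedModType R) (f : V -> R) (x v : V) (t : R) :
  derivable f (x + t *: v) v ->
  is_derive t 1 (fun s => f (x + s *: v)) ('D_v f (x + t *: v)).
Proof.
move=> df.
have E : (fun h : R => h^-1 *: (((fun s => f (x + s *: v)) \o shift t) (h *: (1 : R)) - f (x + t *: v))) =
  (fun h => h^-1 *: ((f \o shift (x + t *: v)) (h *: v) - f (x + t *: v))).
  apply/funext => h /=; congr (_ *: (f _ - _)).
  by rewrite -[X in X + t]/(h * 1) mulr1 scalerDl addrCA.
split; first by rewrite /derivable E.
by rewrite /derive E.
Qed.

Lemma norm_cV_le n (x y : 'cV[R]_n) :
  (forall i, `|x i ord0| <= `|y i ord0|) -> `|x| <= `|y|.
Proof.
move=> xy; rewrite -[`|x|]/(mx_norm x) -[`|y|]/(mx_norm y) !mx_normrE.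
apply/bigmax_leP; split => [|[i j] _ /=].
  exact: bigmax_ge_id.
apply: (le_trans (y := `|y i j|)); first by rewrite (ord1 j).
exact: (le_bigmax _ (fun ij => `|y ij.1 ij.2|) (i, j)).
Qed.

(** Moving from [x] to [y] one coordinate at a time, the mean value theorem applies
    to each step.  The intermediate points stay as close to [x] as [y] is, so the
    partial derivatives there tend to those at [x]: this gives both continuity and
    differentiability in every direction. *)
Lemma MVT_cV n (f : 'cV[R]_n -> R) (x y : 'cV[R]_n) :
  (forall i x, derivable f x (delta_mx i ord0)) ->
  exists xi : 'I_n -> 'cV[R]_n, (forall i, `|xi i - x| <= `|y - x|) /\
    f y - f x = \sum_i (y i ord0 - x i ord0) * partial i f (xi i).
Proof.
move=> df.
pose w k : 'cV[R]_n := \col_i (if (i < k)%N then y i ord0 else x i ord0).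
have wS (i : 'I_n) : w i.+1 = w i + (y i ord0 - x i ord0) *: delta_mx i ord0.
  apply/colP => j; rewrite !mxE eqxx andbT ltnS leq_eqVlt.
  case: (eqVneq j i) => [->|ji] /=.
    by rewrite eqxx ltnn /= mulr1 addrC subrK.
  by rewrite -val_eqE /= in ji; rewrite (negbTE ji) mulr0 addr0.
have step (i : 'I_n) : exists xi : 'cV[R]_n, `|xi - x| <= `|y - x| /\
    f (w i.+1) - f (w i) = (y i ord0 - x i ord0) * partial i f xi.
  set d := y i ord0 - x i ord0; pose e : 'cV[R]_n := delta_mx i ord0.
  pose phi (t : R) := f (w i + (d * t) *: e).
  have dphi (t : R) : is_derive t 1 phi (d * partial i f (w i + (d * t) *: e)).
    have H := is_derive_line (df i (w i + (d * t) *: e)).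
    have -> : phi = (fun s => f (w i + s *: e)) \o (fun t => d * t).
      by apply/funext.
    rewrite mulrC; apply: is_derive1_comp; 
      have := @is_deriveZ R R R id d t 1 1 (is_derive_id _ _).
    by rewrite -[d *: 1]/(d * 1) mulr1.
  have cphi : {within `[0, 1], continuous phi}.
    apply: continuous_subspaceT => t.
    by apply/differentiable_continuous/derivable1_diffP; case: (dphi t).
  have [c] := MVT_segment ler01 (fun t _ => dphi t) cphi.
  rewrite in_itv/= => /andP[c0 c1].
  rewrite subr0 mulr1 /phi mulr1 mulr0 scale0r addr0 -wS => ->.
  exists (w i + (d * c) *: e); split => //.
  apply: norm_cV_le => j; rewrite !mxE eqxx andbT.
  case: (eqVneq j i) => [->|ji] /=.
    rewrite ltnn mulr1 addrAC subrr add0r normrM ler_piMr// ger0_norm//.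
  rewrite mulr0 addr0; case: ifP => // _.
  by rewrite subrr normr0.
have [xi xiP] := choice step.
exists xi; split => [i|]; first exact: (xiP i).1.
under eq_bigr => i _ do rewrite -(xiP i).2.
rewrite -(big_mkord xpredT (fun i => f (w i.+1) - f (w i))) telescope_sumr//.
congr (f _ - f _); apply/colP => i; rewrite !mxE ?ltn_ord//.
Qed.

Lemma cvg_norm_sub_le (V : normedModType R) (W : normedModType R) (T : Type)
    (F : set_system T) {FF : Filter F} (u : T -> V) (w : T -> W) (x : V) (y : W) :
  (forall t, `|u t - x| <= `|w t - y|) -> w @ F --> y -> u @ F --> x.
Proof.
move=> uw wy; apply/cvgrPdist_lt => e e0.
move/cvgrPdist_lt : wy => /(_ _ e0); apply: filterS => t; rewrite distrC => h.
by rewrite distrC; apply: le_lt_trans h.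
Qed.

Lemma C1_continuous n (f : 'cV[R]_n -> R) : C1 f -> continuous f.
Proof.
move=> fC1 x.
have [xi xiP] := choice (fun y => MVT_cV x y (fun i z => (fC1 i).1 z)).
have -> : f = (fun y => f x + \sum_i (y i ord0 - x i ord0) * partial i f (xi y i)).
  by apply/funext => y; rewrite -(xiP y).2 addrC subrK.
rewrite /continuous_at.
have -> : f x + \sum_i (x i ord0 - x i ord0) * partial i f (xi x i) = f x + \sum_(i < n) 0.
  by congr (_ + _); apply: eq_bigr => i _; rewrite subrr mul0r.
apply: (@cvgD _ _ _ (nbhs x) _ (fun=> f x)); first exact: cvg_cst.
apply: (cvg_big cvgD_continuous) => i _.
rewrite -[X in _ --> X](mul0r (partial i f x)); apply: cvgM.
  rewrite -[X in _ --> X](subrr (x i ord0)); apply: cvgB; last exact: cvg_cst.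
  exact: coord_continuous.
apply: (@continuous_cvg _ _ _ (nbhs x) _ (fun y => xi y i) (partial i f)).
  exact: (fC1 i).2.
apply: (@cvg_norm_sub_le _ _ _ (nbhs x) _ _ id x x) => [y|]; last exact: cvg_id.
exact: (xiP y).1.
Qed.

Lemma C1_is_derive n (f : 'cV[R]_n -> R) (x v : 'cV[R]_n) : C1 f ->
  is_derive x v f (\sum_i v i ord0 * partial i f x).
Proof.
move=> fC1.
have [xi xiP] := choice (fun y => MVT_cV x y (fun i z => (fC1 i).1 z)).
have H : h^-1 *: ((f \o shift x) (h *: v) - f x) @[h --> (0:R)^'] -->
    \sum_i v i ord0 * partial i f x.
  have : \sum_i v i ord0 * partial i f (xi (h *: v + x) i) @[h --> (0:R)^'] -->
      \sum_i v i ord0 * partial i f x.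
    apply: (cvg_big cvgD_continuous) => i _.
    apply: cvgM; first exact: cvg_cst.
    apply: (@continuous_cvg _ _ _ _ _
      (fun h : R => xi (h *: v + x) i) (partial i f)); first exact: (fC1 i).2.
    apply: (@cvg_norm_sub_le _ _ _ _ _ _ (fun h : R => h *: v + x) _ x).
      by move=> h; exact: (xiP _).1.
    rewrite -[X in _ --> X]add0r -(scale0r v); apply: cvgD; last exact: cvg_cst.
    apply: cvgZr_tmp; apply: nbhs_dnbhs.
  apply: cvg_trans; apply: near_eq_cvg; near=> h.
  rewrite /= (xiP _).2 scaler_sumr; apply: eq_bigr => i _.
  rewrite -[h^-1 *: (_ * _)]/(h^-1 * (_ * _)) !mxE addrK -mulrA mulrA mulVf ?mul1r//.
  by near: h; exact: nbhs_dnbhs_neq.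
split; first by apply: cvgP H.
exact: cvg_lim H.
Unshelve. all: by end_near. Qed.

Lemma cvg_cV n (T : Type) (F : set_system T) {FF : Filter F}
    (u : T -> 'cV[R]_n) (x : 'cV[R]_n) :
  (forall i, u t i ord0 @[t --> F] --> x i ord0) -> u @ F --> x.
Proof.
move=> ux; apply/cvg_ballP => e e0.
have : \forall t \near F, forall i, ball (x i ord0) e (u t i ord0).
  apply: filter_forall => i.
  by move/cvg_ballP : (ux i); apply.
by apply: filterS => t h; split => // i j; rewrite (ord1 j); exact: h.
Qed.

Lemma continuous_sum n (V : topologicalType) (F : 'I_n -> V -> R) :
  (forall i, continuous (F i)) -> continuous (fun x => \sum_i F i x).
Proof. by move=> h; apply: (continuous_big cvgD_continuous) => i _; exact: h. Qed.

Lemma continuous_scale_fun (V : topologicalType) (c : R) (f : V -> R) :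
  continuous f -> continuous (fun x => c * f x).
Proof. by move=> cf x; apply: cvgM; [exact: cvg_cst|exact: cf]. Qed.

Lemma continuous_affine m n (A : 'M[R]_(m, n)) (b : 'cV[R]_m) :
  continuous (fun z : 'cV[R]_n => A *m z + b).
Proof.
move=> z; apply: (@cvg_cV _ _ (nbhs z)) => i.
rewrite !mxE; under eq_fun do rewrite !mxE.
apply: (@cvgD _ _ _ (nbhs z) _ (fun z => \sum_k A i k * z k ord0) (fun=> b i ord0));
  last exact: cvg_cst.
apply: (@continuous_sum _ _ (fun k (z : 'cV[R]_n) => A i k * z k ord0)) => k.
by apply: continuous_scale_fun; exact: coord_continuous.
Qed.

(** The derivative along a basis vector of the source is the derivative of [f]
    along a column of [A]. *)
Lemma is_derive_affine m n (f : 'cV[R]_m -> R) (A : 'M[R]_(m, n)) b z i :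
  C1 f -> is_derive z (delta_mx i ord0) (fun z => f (A *m z + b))
    (\sum_k A k i * partial k f (A *m z + b)).
Proof.
move=> fC1; have [df vf] := C1_is_derive (A *m z + b) (col i A) fC1.
have E : (fun h : R => h^-1 *: (((fun z => f (A *m z + b)) \o shift z)
      (h *: (delta_mx i ord0 : 'cV[R]_n)) - f (A *m z + b))) =
    (fun h => h^-1 *: ((f \o shift (A *m z + b)) (h *: col i A) - f (A *m z + b))).
  apply/funext => h /=; congr (_ *: (f _ - _)).
  by rewrite mulmxDr -scalemxAr -colE addrA.
split; first by rewrite /derivable E.
rewrite /derive E [LHS]vf; apply: eq_bigr => k _.
by rewrite mxE.
Qed.

Lemma partial_affine m n (f : 'cV[R]_m -> R) (A : 'M[R]_(m, n)) b i :
  C1 f -> partial i (fun z => f (A *m z + b)) =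
    (fun z => \sum_k A k i * partial k f (A *m z + b)).
Proof. by move=> fC1; apply/funext => z; case: (is_derive_affine A b z i fC1). Qed.

Lemma C1_affine m n (f : 'cV[R]_m -> R) (A : 'M[R]_(m, n)) b :
  C1 f -> C1 (fun z => f (A *m z + b)).
Proof.
move=> fC1 i; split => [z|]; first by case: (is_derive_affine A b z i fC1).
rewrite partial_affine//; apply: continuous_sum => k.
apply: continuous_scale_fun => z.
apply: continuous_comp; first exact: continuous_affine.
exact: (fC1 k).2.
Qed.

Lemma C1_sum n m (c : 'I_m -> R) (F : 'I_m -> 'cV[R]_n -> R) :
  (forall k, C1 (F k)) -> C1 (fun z => \sum_k c k * F k z) /\
  forall i, partial i (fun z => \sum_k c k * F k z) =
    (fun z => \sum_k c k * partial i (F k) z).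
Proof.
move=> FC1.
have D i z : is_derive z (delta_mx i ord0) (fun z => \sum_k c k * F k z)
    (\sum_k c k * partial i (F k) z).
  have -> : (fun z => \sum_k c k * F k z) = \sum_k (c k *: F k).
    by apply/funext => y; rewrite fct_sumE.
  apply: is_derive_sum => k; apply: is_deriveZ.
  by apply: DeriveDef => //; exact: (FC1 k i).1.
have E i : partial i (fun z => \sum_k c k * F k z) =
    (fun z => \sum_k c k * partial i (F k) z).
  by apply/funext => z; case: (D i z).
split => // i; split => [z|]; first by case: (D i z).
rewrite E; apply: continuous_sum => k; apply: continuous_scale_fun.
exact: (FC1 k i).2.
Qed.

Lemma C2_affine m n (f : 'cV[R]_m -> R) (A : 'M[R]_(m, n)) b :
  C2 f -> C2 (fun z => f (A *m z + b)).
Proof.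
move=> [fC1 fC2]; split => [|i]; first exact: C1_affine.
rewrite partial_affine//.
by apply: (C1_sum (A ^~ i) _).1 => k; exact: C1_affine.
Qed.

Lemma partial2_affine m n (f : 'cV[R]_m -> R) (A : 'M[R]_(m, n)) b i j z :
  C2 f -> partial i (partial j (fun z => f (A *m z + b))) z =
    \sum_k \sum_l A k j * A l i * partial l (partial k f) (A *m z + b).
Proof.
move=> [fC1 fC2]; rewrite partial_affine//.
rewrite (C1_sum (A ^~ j) (fun k => C1_affine A b (fC2 k))).2.
apply: eq_bigr => k _; rewrite partial_affine// mulr_sumr.
by apply: eq_bigr => l _; rewrite mulrA.
Qed.

End calculus.

(** * Measurability of continuous functions on R^n *)

Section measurability.
Context {R : realType}.

(** [f] is the pointwise limit of its compositions with the roundings of the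
    coordinates to multiples of [1 / k.+1], which take countably many values. *)
Lemma continuous_measurable_cV n (f : 'cV[R]_n -> R) :
  continuous f -> measurable_fun setT f.
Proof.
move=> cf.
pose q (k : nat) (x : 'cV[R]_n) : 'cV[R]_n :=
  \col_i ((Num.floor (k.+1%:R * x i ord0))%:~R / k.+1%:R).
apply: (@measurable_fun_cvg _ _ _ _ (fun k => f \o q k)) => [k|x _].
  pose E (u : 'cV[int]_n) : set 'cV[R]_n := \bigcap_(i in [set: 'I_n])
    [set x : 'cV[R]_n | k.+1%:R * x i ord0 \in
      `[(u i ord0)%:~R, (u i ord0 + 1)%:~R[].
  have mE u : measurable (E u).
    apply: fin_bigcap_measurable => [|i _]; first exact: finite_finset.
    have mf : measurable_fun setT (fun x : 'cV[R]_n => k.+1%:R * x i ord0).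
      by apply: measurable_funM => //; exact: measurable_entry.
    by have := mf measurableT _ (measurable_itv `[(u i ord0)%:~R, (u i ord0 + 1)%:~R[);
      rewrite setTI.
  move=> _ B mB; rewrite setTI.
  rewrite (_ : _ @^-1` B = \bigcup_(u in [set: 'cV[int]_n])
     (if f (\col_i ((u i ord0)%:~R / k.+1%:R)) \in B then E u else set0)).
    apply: countable_bigcupT_measurable => [|u]; first exact: countableP.
    by case: ifP.
  apply/seteqP; split => [x /= Bx|x [u _]].
    exists (\col_i Num.floor (k.+1%:R * x i ord0)) => //.
    rewrite ifT.
      by move=> i _ /=; rewrite in_itv/= mxE floor_itv.
    rewrite inE (_ : \col_i _ = q k x)//.
    by apply/colP => i; rewrite !mxE.
  case: ifPn => // /[!inE] Bu Ex /=; rewrite (_ : q k x = \col_i ((u i ord0)%:~R / k.+1%:R))//.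
  apply/colP => i; rewrite !mxE; congr (_%:~R / _).
  by have := Ex i I; rewrite /= in_itv/=; exact: floor_def.
apply: continuous_cvg; first exact: cf.
apply: cvg_cV => i.
apply/cvgrPdist_lt => e e0.
have := near_infty_natSinv_lt (PosNum e0); apply: filterS => k /= ke.
rewrite mxE distrC; set y := x i ord0.
have k0 : 0 < k.+1%:R :> R by rewrite ltr0n.
have -> : (Num.floor (k.+1%:R * y))%:~R / k.+1%:R - y =
   ((Num.floor (k.+1%:R * y))%:~R - k.+1%:R * y) / k.+1%:R.
  by rewrite mulrBl mulrAC divff ?mul1r// gt_eqF.
rewrite normrM (ger0_norm (x := _^-1)) ?invr_ge0 ?ltW//.
apply: le_lt_trans ke; rewrite ler_piMl ?invr_ge0 ?(ltW k0)// distrC.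
by rewrite ger0_norm ?subr_ge0 ?floor_le// lerBlDl -intrD1 ltW// floorD1_gt.
Qed.

Lemma measurable_affine m n (A : 'M[R]_(m, n)) (b : 'cV[R]_m) :
  measurable_fun setT (fun z : 'cV[R]_n => A *m z + b).
Proof.
apply: measurable_fun_mxP => i j; rewrite (ord1 j).
under eq_fun do rewrite !mxE.
apply: measurable_funD => //; apply: measurable_sum => k.
by apply: measurable_funM => //; exact: measurable_entry.
Qed.

End measurability.

(** * Changes of variables and iterated integrals for Lebesgue measure *)

Section change_of_variables.
Context {R : realType}.
Local Open Scope ereal_scope.
Local Notation leb := (@lebesgue_measure R).

Lemma ge0_integral_affine (a b : R) (h : R -> \bar R) : (0 < a)%R ->
  measurable_fun setT h -> (forall t, 0 <= h t) ->
  \int[leb]_t h t = a%:E * \int[leb]_t h (a * t + b)%R.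
Proof.
move=> a0 mh h0.
pose phi (t : R) : measurableTypeR R := (a * t + b)%R.
have mphi : measurable_fun setT phi.
  by apply: measurable_funD => //; exact: measurable_funM.
pose ann : {nonneg R} := NngNum (ltW a0).
(* The measure structure of the pushforward abstracts over measurability. *)
pose nu_ : {measure set (measurableTypeR R) -> \bar R} :=
  mscale ann (pushforward leb phi).
pose nu := nu_ mphi.
have E (A : set (measurableTypeR R)) : measurable A -> leb A = nu A.
  apply: lebesgue_measure_unique => _ [[x y] /=] _ <-.
  rewrite /nu /nu_/= /mscale/= /pushforward.
  have -> : phi @^-1` `]x, y] = `]((x - b) / a)%R, ((y - b) / a)%R]%classic.
    by apply/seteqP; split => t /=;
      rewrite !in_itv/= /phi ltr_pdivrMr// ler_pdivlMr// ltrBlDr lerBrDr (mulrC t).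
  rewrite !lebesgue_measure_itv/= !lte_fin ltr_pM2r ?invr_gt0// ltrD2r.
  case: ifPn => _; last by rewrite mule0.
  rewrite -!EFinB -EFinM; congr EFin.
  by rewrite -mulrBl opprB addrA subrK mulrC divfK// gt_eqF.
transitivity (\int[nu]_t h t).
  by apply: eq_measure_integral => A mA _; exact: E.
rewrite ge0_integral_mscale//; congr *%E.
by rewrite ge0_integral_pushforward.
Qed.

(** The case [a = -1], excluded from [ge0_integral_affine] by the sign condition. *)
Lemma ge0_integral_opp (h : R -> \bar R) :
  measurable_fun setT h -> (forall t, 0 <= h t) ->
  \int[leb]_t h t = \int[leb]_t h (- t)%R.
Proof.
move=> mh h0.
have mN : measurable_fun setT (-%R : R -> measurableTypeR R) by [].
transitivity (\int[pushforward leb (-%R : R -> measurableTypeR R)]_t h t).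
  by apply: eq_measure_integral => A mA _; exact/esym/lebesgue_measureN.
by rewrite ge0_integral_pushforward.
Qed.

Lemma cV_cons0 n (t : R) (y : 'cV[R]_n) : cV_cons (t, y) ord0 ord0 = t.
Proof.
have -> : (ord0 : 'I_n.+1) = lshift n (ord0 : 'I_1) by exact/val_inj.
by rewrite /cV_cons (@col_mxEu _ 1%N n 1%N) mxE eqxx mulr1n.
Qed.

Lemma ge0_integral_cVS n (h : 'cV[R]_n.+1 -> \bar R) :
  measurable_fun setT h -> (forall x, 0 <= h x) ->
  \int[lebesgue_cV n.+1]_x h x =
  \int[leb]_t \int[lebesgue_cV n]_y h (cV_cons (t, y)).
Proof.
move=> mh h0.
transitivity (\int[pushforward (leb \x lebesgue_cV n) (@cV_cons R n)]_x h x).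
  by [].
rewrite ge0_integral_pushforward//; last exact: measurable_cV_cons.
rewrite preimage_setT fubini_tonelli1 => [|| x]; [by []| |exact: h0].
by apply: measurableT_comp => //; exact: measurable_cV_cons.
Qed.

Lemma measurable_integral_cV_cons n (h : 'cV[R]_n.+1 -> \bar R) :
  measurable_fun setT h -> (forall x, 0 <= h x) ->
  measurable_fun setT (fun t : R => \int[lebesgue_cV n]_y h (cV_cons (t, y))).
Proof.
move=> mh h0.
apply: (measurable_fun_fubini_tonelli_F (h \o @cV_cons R n)) => [|x]; last exact: h0.
by apply: measurableT_comp => //; exact: measurable_cV_cons.
Qed.

Lemma measurable_cV_cons1 n (h : 'cV[R]_n.+1 -> \bar R) (t : R) :
  measurable_fun setT h -> measurable_fun setT (fun y => h (cV_cons (t, y))).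
Proof.
move=> mh; apply: (measurableT_comp mh).
by apply: (measurableT_comp (@measurable_cV_cons R n)); exact: measurable_pair1.
Qed.

(** A lower triangular affine map acts on the first coordinate alone and, for a fixed
    first coordinate, as a smaller such map on the others.  The one-dimensional
    scalings by the diagonal entries multiply up to the determinant. *)
Lemma ge0_integral_trig n (A : 'M[R]_n) (b : 'cV[R]_n) (h : 'cV[R]_n -> \bar R) :
  is_trig_mx A -> (forall i, 0 < A i i)%R ->
  measurable_fun setT h -> (forall x, 0 <= h x) ->
  \int[lebesgue_cV n]_x h x =
  (\det A)%:E * \int[lebesgue_cV n]_x h (A *m x + b)%R.
Proof.
move=> tA A0 mh h0; rewrite det_trig//.
elim: n => [|n IHn] in A b h tA A0 mh h0 *.
  rewrite big_ord0 mul1e; apply: eq_integral => x _; congr h.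
  by rewrite [LHS]flatmx0 [RHS]flatmx0.
have /is_trig_mxP trA := tA.
pose B : 'M[R]_(1 + n) := A; pose c : 'cV[R]_(1 + n) := b.
have BE : B = block_mx (A ord0 ord0)%:M 0 (dlsubmx B) (drsubmx B).
  rewrite -[LHS]submxK; congr block_mx.
    by apply/matrixP => i j; rewrite !mxE (ord1 i) (ord1 j) eqxx mulr1n;
      congr (A _ _); exact/val_inj.
  apply/matrixP => i j; rewrite !mxE; apply: trA.
  by rewrite (ord1 i).
have cE : c = col_mx (b ord0 ord0)%:M (dsubmx c).
  rewrite -[LHS](@vsubmxK _ 1 n 1); congr (@col_mx R 1 n 1 _ _).
  by apply/matrixP => i j; rewrite !mxE (ord1 i) (ord1 j) eqxx mulr1n;
    congr (b _ _); exact/val_inj.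
have affE t y : (A *m cV_cons (t, y) + b)%R = cV_cons
    (A ord0 ord0 * t + b ord0 ord0, drsubmx B *m y + (t *: dlsubmx B + dsubmx c))%R.
  transitivity (block_mx (A ord0 ord0)%:M 0 (dlsubmx B) (drsubmx B) *m
      (col_mx t%:M y : 'cV[R]_(1 + n)) + col_mx (b ord0 ord0)%:M (dsubmx c))%R.
    by rewrite -BE -cE.
  rewrite mul_block_col mul0mx addr0 add_col_mx -!scalar_mxM -raddfD/=.
  rewrite /cV_cons/=; congr (@col_mx R 1 n 1 _ _).
  by rewrite mul_mx_scalar addrCA addrA.
rewrite big_ord_recl EFinM.
have tB : is_trig_mx (drsubmx B).
  by apply/is_trig_mxP => i j ij; rewrite !mxE; exact: trA.
have B0 i : (0 < drsubmx B i i)%R by rewrite !mxE.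
have maff : measurable_fun setT (fun x : 'cV[R]_n.+1 => h (A *m x + b)%R).
  by apply: (measurableT_comp mh); exact: measurable_affine.
rewrite [in RHS]ge0_integral_cVS//.
rewrite -muleA -ge0_integralZl//; last 3 first.
- exact: (measurable_integral_cV_cons maff (fun x => h0 _)).
- by move=> t _; apply: integral_ge0 => y _; exact: h0.
- by rewrite lee_fin; apply: prodr_ge0 => i _; exact: ltW.
rewrite ge0_integral_cVS// (ge0_integral_affine (b ord0 ord0) (A0 ord0)); last 2 first.
- exact: (measurable_integral_cV_cons mh h0).
- by move=> t; apply: integral_ge0 => y _; exact: h0.
congr *%E; apply: eq_integral => t _.
rewrite (IHn (drsubmx B) (t *: dlsubmx B + dsubmx c)%R) => //.
- congr *%E; last by apply: eq_integral => y _; rewrite affE.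
  congr EFin; apply: eq_bigr => i _; rewrite !mxE; congr (A _ _); exact/val_inj.
- exact: measurable_cV_cons1.
Qed.

Definition set_coord n (i : 'I_n) (z : 'cV[R]_n) (t : R) : 'cV[R]_n :=
  \col_j (if j == i then t else z j ord0).

Lemma set_coord0_cons n (y : 'cV[R]_n) (s t : R) :
  set_coord ord0 (cV_cons (s, y)) t = cV_cons (t, y).
Proof.
apply/colP => j; rewrite mxE; case: eqP => [->|/eqP j0]; first by rewrite cV_cons0.
rewrite /cV_cons/=; case: (unliftP ord0 j) j0 => [k ->|->]; last by rewrite eqxx.
move=> _; have -> : lift ord0 k = rshift 1 k by exact/val_inj.
by rewrite !(@col_mxEd _ 1 n 1).
Qed.

Lemma set_coord_lift_cons n (j : 'I_n) (y : 'cV[R]_n) (s t : R) :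
  set_coord (lift ord0 j) (cV_cons (t, y)) s = cV_cons (t, set_coord j y s).
Proof.
apply/colP => k; rewrite mxE; case: (unliftP ord0 k) => [l ->|->].
  have E (x : 'cV[R]_n) : cV_cons (t, x) (lift ord0 l) ord0 = x l ord0.
    have -> : lift ord0 l = rshift 1 l by exact/val_inj.
    by rewrite /cV_cons (@col_mxEd _ 1 n 1).
  by rewrite !E mxE (inj_eq lift_inj).
by rewrite !cV_cons0 (negbTE (neq_lift _ _)).
Qed.

(** By induction on the dimension.  If [i] is the first coordinate, Tonelli's theorem
    makes it the innermost variable; otherwise the induction hypothesis applies for
    each value of the first coordinate. *)
Lemma le_integral_coord n (i : 'I_n) (a b : 'cV[R]_n -> \bar R) :
  measurable_fun setT a -> measurable_fun setT b ->
  (forall x, 0 <= a x) -> (forall x, 0 <= b x) ->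
  (forall z, \int[leb]_t a (set_coord i z t) <= \int[leb]_t b (set_coord i z t)) ->
  \int[lebesgue_cV n]_x a x <= \int[lebesgue_cV n]_x b x.
Proof.
elim: n => [|n IHn] in i a b *; first by case: i.
move=> ma mb a0 b0 ab.
have mcons (h : 'cV[R]_n.+1 -> \bar R) : measurable_fun setT h ->
    measurable_fun setT (h \o @cV_cons R n).
  by move=> mh; apply: measurableT_comp => //; exact: measurable_cV_cons.
rewrite !ge0_integral_cVS//.
case: (unliftP ord0 i) ab => [j ->|->] ab.
  apply: ge0_le_integral => //.
  - by move=> t _; apply: integral_ge0.
  - exact: (measurable_integral_cV_cons ma a0).
  - exact: (measurable_integral_cV_cons mb b0).
  move=> t _; apply: (IHn j) => //.
  - exact: measurable_cV_cons1.
  - exact: measurable_cV_cons1.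
  - move=> y; have := ab (cV_cons (t, y)).
    by under eq_integral do rewrite set_coord_lift_cons;
      under [X in _ <= X -> _]eq_integral do rewrite set_coord_lift_cons.
rewrite (fubini_tonelli (a \o @cV_cons R n)) => [||x]; [|exact: mcons|exact: a0].
rewrite (fubini_tonelli (b \o @cV_cons R n)) => [||x]; [|exact: mcons|exact: b0].
apply: ge0_le_integral => //.
- by move=> y _; apply: integral_ge0 => t _; exact: a0.
- apply: (measurable_fun_fubini_tonelli_G (a \o @cV_cons R n)) => [|x]; [exact: mcons|exact: a0].
- apply: (measurable_fun_fubini_tonelli_G (b \o @cV_cons R n)) => [|x]; [exact: mcons|exact: b0].
move=> y _; have := ab (cV_cons (0%R, y)).
by under eq_integral do rewrite set_coord0_cons;
      under [X in _ <= X -> _]eq_integral do rewrite set_coord0_cons.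
Qed.

End change_of_variables.

(** * Integration against a density *)

Section density.
Local Open Scope ereal_scope.
Context d (T : measurableType d) (R : realType).
Variable mu : {measure set T -> \bar R}.

Import HBNNSimple.

(** The defining property of a density concerns indicator functions; simple
    functions and monotone convergence extend it to nonnegative functions. *)
Lemma ge0_integral_density (nu : {measure set T -> \bar R}) (p : T -> R)
    (f : T -> \bar R) :
  measurable_fun setT p -> (forall x, 0 <= p x)%R ->
  (forall A, measurable A -> nu A = \int[mu]_(x in A) (p x)%:E) ->
  measurable_fun setT f -> (forall x, 0 <= f x) ->
  \int[nu]_x f x = \int[mu]_x (f x * (p x)%:E).
Proof.
move=> mp p0 nuE mf f0.
pose h := nnsfun_approx measurableT mf.
have -> : \int[nu]_x f x = lim (\int[nu]_x (EFin \o h n) x @[n --> \oo]).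
  have fE x : f x = lim ((EFin \o h n) x @[n --> \oo]).
    by apply/esym/cvg_lim => //; exact: cvg_nnsfun_approx.
  under eq_integral do rewrite fE.
  apply: monotone_convergence => //.
  - by move=> n; exact/measurable_EFinP.
  - by move=> n x _ //=; rewrite lee_fin.
  - by move=> x _ a b ab; rewrite lee_fin; exact/lefP/nd_nnsfun_approx.
have -> : \int[mu]_x (f x * (p x)%:E) =
    lim (\int[mu]_x ((EFin \o h n) x * (p x)%:E) @[n --> \oo]).
  have fg x : f x * (p x)%:E = lim (((EFin \o h n) x * (p x)%:E) @[n --> \oo]).
    by apply/esym/cvg_lim => //; apply: cvgeZr => //; exact: cvg_nnsfun_approx.
  under eq_integral do rewrite fg.
  apply: monotone_convergence => [//| | |].
  - by move=> n; apply/emeasurable_funM; exact/measurable_EFinP.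
  - by move=> n x _ /=; rewrite mule_ge0 ?lee_fin.
  - by move=> x _ a b ab/=; rewrite lee_wpmul2r ?lee_fin//; exact/lefP/nd_nnsfun_approx.
suff suf n : \int[mu]_x ((EFin \o h n) x * (p x)%:E) = \int[nu]_x (EFin \o h n) x.
  by under eq_fun do rewrite -suf.
have indich m r : measurable_fun setT (fun x => (r * \1_(h m @^-1` [set r]) x)%:E).
  by apply/measurable_EFinP; exact: measurable_funM.
transitivity (\int[nu]_x (\sum_(y \in range (h n)) (y * \1_(h n @^-1` [set y]) x)%:E));
  last by apply: eq_integral => t _; rewrite /= fimfunE -fsumEFin.
rewrite ge0_integral_fsum//; last by move=> m y _; exact: nnfun_muleindic_ge0.
transitivity (\int[mu]_x (\sum_(y \in range (h n))
    (y * \1_(h n @^-1` [set y]) x)%:E * (p x)%:E)).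
  under [RHS]eq_integral => x xE.
    rewrite -ge0_mule_fsuml => [|y]; last exact: nnfun_muleindic_ge0.
    rewrite fsumEFin // -(fimfunE _ x); over.
  by [].
rewrite ge0_integral_fsum//; last 2 first.
- by move=> y; apply: emeasurable_funM => //; exact/measurable_EFinP.
- by move=> y x _; rewrite mule_ge0 ?lee_fin//; exact: nnfun_muleindic_ge0.
apply: eq_fsbigr => r _.
under eq_integral do rewrite EFinM -muleA.
rewrite [RHS]integralZl_indic_nnsfun// integral_indic//.
have [r0|r0] := leP 0%R r.
  rewrite ge0_integralZl//; last 2 first.
  - by apply: emeasurable_funM; exact/measurable_EFinP.
  - by move=> x _; rewrite mule_ge0 ?lee_fin.
  congr *%E; rewrite setIT nuE// [RHS]integral_mkcond.
  by apply: eq_integral => x _; rewrite epatch_indic/= muleC.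
rewrite preimage_nnfun0// set0I measure0 mule0.
under eq_integral do rewrite indic0 mul0e mule0.
exact: integral0.
Qed.

Definition density (p : T -> R) : set T -> \bar R :=
  fun A => \int[mu]_(x in A) (p x)%:E.

Variable p : T -> R.
Hypotheses (mp : measurable_fun setT p) (p0 : forall x, (0 <= p x)%R).

Let density0 : density p set0 = 0.
Proof. exact: integral_set0. Qed.

Let density_ge0 A : 0 <= density p A.
Proof. by apply: integral_ge0 => x _; rewrite lee_fin. Qed.

Let density_sigma_additive : semi_sigma_additive (density p).
Proof.
move=> F mF tF mUF; rewrite /density ge0_integral_bigcup//.
- by apply: is_cvg_ereal_nneg_natsum_cond => n _ _; exact: density_ge0.
- by apply/measurable_funTS/measurable_EFinP.
- by move=> x _; rewrite lee_fin.
Qed.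

HB.instance Definition _ := isMeasure.Build _ _ _
  (density p) density0 density_ge0 density_sigma_additive.

End density.

(** * The substitution v = t^2 / 2 + r for measurable integrands *)

Section real_line.
Context {R : realType}.
Local Notation leb := (@lebesgue_measure R).

Lemma is_derive1_continuous (F f : R -> R) :
  (forall t : R, is_derive t 1 F (f t)) -> continuous F.
Proof.
by move=> dF t; apply/differentiable_continuous/derivable1_diffP; case: (dF t).
Qed.

Lemma integral_derive_segment (F f : R -> R) (a b : R) :
  (forall t : R, is_derive t 1 F (f t)) -> continuous f -> a <= b ->
  (\int[leb]_(t in `[a, b]) (f t)%:E = (F b - F a)%:E)%E.
Proof.
move=> dF cf; rewrite le_eqVlt => /predU1P[->|ab].
  by rewrite set_itv1 integral_set1 subrr.
have cF := is_derive1_continuous dF.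
apply: continuous_FTC2 => //.
- exact: continuous_subspaceT.
- split.
  + by move=> x _; case: (dF x).
  + exact/cvg_at_right_filter/cF.
  + exact/cvg_at_left_filter/cF.
- by move=> x _; rewrite derive1E; case: (dF x).
Qed.

(** The difference quotient is within [`|h|] of the limit, including at [t = 0]
    where the two branches of the norm meet. *)
Lemma is_derive_half_mul_norm (t : R) : is_derive t 1 (fun s => s * `|s| / 2) `|t|.
Proof.
have B (h : R) : `|h| * `|h^-1 * ((h + t) * `|h + t| / 2 - t * `|t| / 2) - `|t| |
    <= `|h| * `|h|.
  have [->|h0] := eqVneq h 0; first by rewrite normr0 !mul0r.
  rewrite -normrM mulrBr mulrA divff// mul1r.
  have -> : `|h| * `|h| = h ^+ 2 by rewrite -normrM -expr2 ger0_norm ?sqr_ge0.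
  rewrite ler_norml.
  have := sqr_ge0 h; have := sqr_ge0 t; have := sqr_ge0 (h + t).
  rewrite !expr2; case: (ger0P (h + t)) => ht; case: (ger0P t) => t0 *;
    apply/andP; split; nra.
have H : h^-1 *: (((fun s => s * `|s| / 2) \o shift t) (h *: (1 : R)) -
    t * `|t| / 2) @[h --> (0:R)^'] --> `|t|.
  apply/cvgrPdist_le => e e0.
  near=> h.
  have h0 : h != 0 by near: h; exact: nbhs_dnbhs_neq.
  rewrite distrC /= -[h *: 1]/(h * 1) mulr1.
  apply: (@le_trans _ _ `|h|).
    by have := B h; rewrite ler_pM2l// normr_gt0.
  by near: h; exact: dnbhs0_le.
split; first exact: cvgP H.
exact: cvg_lim H.
Unshelve. all: by end_near. Qed.

Section quadratic_substitution.
Local Open Scope ereal_scope.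
Variable r : R.

Let phi (t : R) : measurableTypeR R := (t * `|t| / 2 + r)%R.

Let dphi (t : R) : is_derive t 1%R phi `|t|%R.
Proof.
have := is_deriveD (is_derive_half_mul_norm t) (is_derive_cst r t 1%R).
by rewrite addr0.
Qed.

Let phi_le : {mono phi : s t / (s <= t)%R}.
Proof.
apply: le_mono => s t st; rewrite /phi ltrD2r.
by case: (ger0P s) => s0; case: (ger0P t) => t0; nra.
Qed.

Let phi_lt : {mono phi : s t / (s < t)%R}.
Proof. exact: leW_mono. Qed.

Let phi_onto x : exists u, phi u = x.
Proof.
have [rx|xr] := leP r x.
  exists (Num.sqrt (2 * (x - r))%R).
  rewrite /phi ger0_norm ?sqrtr_ge0// -expr2 sqr_sqrtr; first lra.
  by rewrite mulr_ge0// subr_ge0.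
exists (- Num.sqrt (2 * (r - x)))%R.
rewrite /phi normrN ger0_norm ?sqrtr_ge0// mulNr -expr2 sqr_sqrtr; first lra.
by rewrite mulr_ge0// subr_ge0 ltW.
Qed.

Let mphi : measurable_fun setT phi.
Proof.
apply: continuous_measurable_fun; exact: is_derive1_continuous dphi.
Qed.

Let mnorm : measurable_fun setT (fun t : R => `|t|%R).
Proof. exact: measurableT_comp. Qed.

(** The increasing map [t |-> t * |t| / 2 + r] transports the measure of density
    [|t|] to Lebesgue measure: this extends substitution, which calculus gives on
    intervals, to integrands that are merely measurable. *)
Lemma ge0_integral_quadratic (h : R -> \bar R) :
  measurable_fun setT h -> (forall x, 0 <= h x) ->
  \int[leb]_(t in `[0%R, +oo[) (h (t ^+ 2 / 2 + r)%R * t%:E) =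
  \int[leb]_(v in `[r, +oo[) h v.
Proof.
move=> mh h0.
pose dens_ : {measure set (measurableTypeR R) -> \bar R} :=
  density leb (fun t : R => `|t|%R).
pose dens := dens_ mnorm (fun t => normr_ge0 t).
pose nu_ : {measure set (measurableTypeR R) -> \bar R} := pushforward dens phi.
pose nu := nu_ mphi.
have E (A : set (measurableTypeR R)) : measurable A -> leb A = nu A.
  apply: lebesgue_measure_unique => _ [[x y] /=] _ <-.
  have [u <-] := phi_onto x; have [w <-] := phi_onto y.
  rewrite lebesgue_measure_itv/= lte_fin phi_lt /nu/= /pushforward.
  have -> : phi @^-1` `]phi u, phi w] = `]u, w]%classic.
    by apply/seteqP; split => t /=; rewrite !in_itv/= phi_lt phi_le.
  rewrite /dens /dens_/= /density; case: ifPn => [uw|].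
    rewrite integral_itv_obnd_cbnd; last exact/measurable_funTS/measurable_EFinP.
    rewrite (integral_derive_segment dphi) ?ltW//; exact: norm_continuous.
  by rewrite -leNgt => wu; rewrite set_itv_ge ?integral_set0// bnd_simp -leNgt.
have mh' : measurable_fun setT (h \_ `[r, +oo[).
  by apply/(measurable_restrictT _ _).1 => //; exact: measurable_funTS.
have h'0 x : 0 <= (h \_ `[r, +oo[) x by apply: erestrict_ge0 => y _; exact: h0.
rewrite [RHS]integral_mkcond.
transitivity (\int[nu]_v (h \_ `[r, +oo[) v); last first.
  by apply: eq_measure_integral => A mA _; rewrite -E.
rewrite ge0_integral_pushforward//= preimage_setT.
rewrite (ge0_integral_density (p := fun t => `|t|%R) (mu := leb))//; last first.
  exact: measurableT_comp.
rewrite [LHS]integral_mkcond; apply: eq_integral => t _.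
rewrite /= !patchE; have [t0|t0] := leP 0%R t.
  rewrite mem_set/= ?in_itv/= ?andbT// ifT.
    by rewrite /phi (ger0_norm t0) expr2.
  by rewrite mem_set//= in_itv/= andbT /phi (ger0_norm t0) lerDr divr_ge0 ?mulr_ge0.
rewrite memNset/=; last by rewrite in_itv/= andbT; apply/negP; rewrite -ltNge.
rewrite memNset/= ?mul0e// in_itv/= andbT; apply/negP; rewrite -ltNge.
by rewrite /phi ltr0_norm//; nra.
Qed.

End quadratic_substitution.

End real_line.

(** * Integration by parts on the half-line *)

Section half_line.
Context {R : realType}.
Local Open Scope ereal_scope.
Local Notation leb := (@lebesgue_measure R).

Let below : set (R * R) := [set x | (0 < x.2 <= x.1)%R].

Let mbelow : measurable below.
Proof.
have -> : below = (snd @^-1` `]0%R, +oo[) `&` ((fun x => x.1 - x.2)%R @^-1` `[0%R, +oo[).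
  apply/seteqP; split => -[t s] /=; rewrite !in_itv/= !andbT subr_ge0.
    by move=> /andP.
  by move=> [s0 st]; apply/andP.
apply: measurableI; rewrite -[X in measurable X]setTI.
  by apply: measurable_snd => //; exact: measurable_itv.
have m : measurable_fun setT (fun x : R * R => x.1 - x.2)%R.
  by apply: measurable_funB.
by apply: m => //; exact: measurable_itv.
Qed.

Let measurable_triangle (a b : R -> \bar R) :
  measurable_fun setT a -> measurable_fun setT b ->
  measurable_fun setT (fun x : R * R => a x.1 * b x.2 * (\1_below x)%:E).
Proof.
move=> ma mb; apply: emeasurable_funM.
  by apply: emeasurable_funM; apply: measurableT_comp.
exact/measurable_EFinP/measurable_indic.
Qed.

(** Both sides integrate [a t * b s] over the region [0 < s <= t]. *)
Lemma tonelli_triangle (a b : R -> \bar R) :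
  measurable_fun setT a -> measurable_fun setT b ->
  (forall t, 0 <= a t) -> (forall t, 0 <= b t) ->
  \int[leb]_(t in `]0%R, +oo[) (a t * \int[leb]_(s in `]0%R, t]) b s) =
  \int[leb]_(s in `]0%R, +oo[) (b s * \int[leb]_(t in `[s, +oo[) a t).
Proof.
move=> ma mb a0 b0.
pose f (x : R * R) := a x.1 * b x.2 * (\1_below x)%:E.
have mf : measurable_fun setT f by exact: measurable_triangle.
have f0 x : 0 <= f x by rewrite /f !mule_ge0 ?lee_fin.
have := fubini_tonelli (m1 := leb) (m2 := leb) f mf f0.
congr (_ = _); rewrite [RHS]integral_mkcond; apply: eq_integral => x _.
  rewrite patchE; case: ifPn => x0; last first.
    under eq_integral => y _.
      rewrite /f indicE memNset/= ?mule0; last first.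
        apply: contraNnot x0 => /andP[y0 yx].
        by rewrite inE/= in_itv/= andbT (lt_le_trans y0).
      over.
    exact: integral0.
  rewrite -ge0_integralZl//; last exact: measurable_funTS.
  rewrite [RHS]integral_mkcond; apply: eq_integral => y _.
  rewrite patchE /f indicE (_ : (x, y) \in below = (y \in `]0%R, x]%classic)).
    by case: ifP; rewrite ?mule1 ?mule0.
  by apply/idP/idP; rewrite !inE/= ?in_itv/=.
rewrite patchE; case: ifPn => x0; last first.
  under eq_integral => y _.
    rewrite /f indicE memNset/= ?mule0; last first.
      apply: contraNnot x0 => /andP[y0 yx].
      by rewrite inE/= in_itv/= andbT.
    over.
  exact: integral0.
rewrite -ge0_integralZl//; last exact: measurable_funTS.
rewrite [RHS]integral_mkcond; apply: eq_integral => y _.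
rewrite patchE /f indicE (_ : (y, x) \in below = (y \in `[x, +oo[%classic)).
  by case: ifP; rewrite ?mule1 ?mule0// muleC.
move: x0; rewrite inE/= in_itv/= andbT => x0.
apply/idP/idP => [/set_mem/andP[_ xy]|/set_mem].
  by apply/mem_set; rewrite /= in_itv/= andbT.
by rewrite /= in_itv/= andbT => xy; apply/mem_set/andP.
Qed.

Let indic_below1 (t s : R) :
  \1_below (t, s) = (\1_(`]0, +oo[) t * \1_(`]0, t]) s)%R :> R.
Proof.
rewrite !indicE -natrM mulnb; congr (_%:R); congr nat_of_bool; apply/idP/idP.
  move=> /set_mem/=/andP[s0 st]; apply/andP.
  by split; apply/mem_set; rewrite /= in_itv/= ?andbT ?s0// (lt_le_trans s0).
by move=> /andP[_ /set_mem/=]; rewrite in_itv/= => ?; apply/mem_set.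
Qed.

Let indic_below2 (t s : R) :
  \1_below (t, s) = (\1_(`]0, +oo[) s * \1_(`[s, +oo[) t)%R :> R.
Proof.
rewrite !indicE -natrM mulnb; congr (_%:R); congr nat_of_bool; apply/idP/idP.
  move=> /set_mem/=/andP[s0 st]; apply/andP.
  by split; apply/mem_set; rewrite /= in_itv/= ?andbT.
move=> /andP[/set_mem s0 /set_mem st]; move: s0 st; rewrite /= !in_itv/= !andbT => s0 st.
apply/mem_set; rewrite /below/= s0; exact: st.
Qed.

(** Integration by parts as an instance of Fubini's theorem: since [V] is not
    differentiated, the weight [u] is only required to be measurable. *)
Lemma half_line_by_parts (chi chi' u V : R -> R) :
  (forall t : R, is_derive t 1%R chi (chi' t)) -> continuous chi' -> chi 0%R = 0%R ->
  measurable_fun setT u -> (forall t, 0 <= u t)%R ->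
  (forall s, (0 < s)%R -> \int[leb]_(t in `[s, +oo[) (u t)%:E = (V s)%:E) ->
  \int[leb]_(s in `]0%R, +oo[) (`|chi' s| * V s)%:E < +oo ->
  \int[leb]_(t in `]0%R, +oo[) (u t * chi t)%:E =
  \int[leb]_(s in `]0%R, +oo[) (chi' s * V s)%:E.
Proof.
move=> dchi cchi' chi0 mu u0 VE foo.
have inner (b : R -> R) s :
    \int[leb]_t (u t * b s * \1_below (t, s))%:E =
    (((fun s => b s * V s) \_ `]0, +oo[) s)%:E%R.
  under eq_integral do rewrite indic_below2.
  rewrite patchE; case: ifPn => s0; last first.
    under eq_integral do rewrite indicE (negbTE s0) mul0r mulr0.
    exact: integral0.
  transitivity (\int[leb]_(t in `[s, +oo[) ((b s)%:E * (u t)%:E)).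
    rewrite [RHS]integral_mkcond; apply: eq_integral => t _.
    by rewrite patchE !indicE s0 mul1r; case: ifP; rewrite ?mulr1 ?mulr0// mulrC.
  have s0' : (0 < s)%R by move: s0; rewrite inE/= in_itv/= andbT.
  rewrite integralZl//; first by rewrite VE.
  apply/integrableP; split; first exact/measurable_funTS/measurable_EFinP.
  under eq_integral do rewrite gee0_abs ?lee_fin//.
  by rewrite VE// ltry.
have mchi' : measurable_fun setT chi' by exact: continuous_measurable_fun.
have mF (b : R -> R) : measurable_fun setT b -> measurable_fun setT
    (fun x : R * R => (u x.1 * b x.2 * \1_below x)%:E).
  by move=> mb; apply: (measurable_triangle (a := EFin \o u) (b := EFin \o b));
    exact/measurable_EFinP.
have iF : (leb \x leb)%E.-integrable setT
    (fun x : R * R => (u x.1 * chi' x.2 * \1_below x)%:E).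
  apply/integrable21ltyP => /=; first exact: mF.
  under eq_integral => s _.
    under eq_integral => t _.
      rewrite /= !normrM (ger0_norm (u0 t)) (ger0_norm (x := \1_below _))//.
      over.
    rewrite (inner (fun s => `|chi' s|%R)).
    over.
  by move: foo; rewrite [X in X < _ -> _]integral_mkcond restrict_EFin.
transitivity (\int[leb]_t \int[leb]_s (u t * chi' s * \1_below (t, s))%:E).
  rewrite integral_mkcond; apply: eq_integral => t _.
  under eq_integral do rewrite indic_below1.
  rewrite patchE; case: ifPn => t0; last first.
    under eq_integral do rewrite indicE (negbTE t0) mul0r mulr0.
    by rewrite integral0.
  transitivity (\int[leb]_(s in `]0%R, t]) ((u t)%:E * (chi' s)%:E)); last first.
    rewrite [LHS]integral_mkcond; apply: eq_integral => s _.
    by rewrite patchE !indicE t0 mul1r; case: ifP; rewrite ?mulr1 ?mulr0.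
  rewrite integral_itv_obnd_cbnd; last exact/measurable_funTS/measurable_EFinP/measurable_funM.
  have t0' : (0 < t)%R by move: t0; rewrite inE/= in_itv/= andbT.
  rewrite integralZl//; last first.
    apply: continuous_compact_integrable; first exact: segment_compact.
    exact: continuous_subspaceT.
  by rewrite (integral_derive_segment dchi)// ?ltW// chi0 subr0.
rewrite (Fubini iF); under eq_integral do rewrite inner.
by rewrite [RHS]integral_mkcond restrict_EFin.
Qed.

End half_line.

(** * Moment inequalities on the half-line *)

(** The integral of a nonnegative function, measurable or not, is the supremum of
    the integrals of the simple functions below it. *)
Lemma le_integral_nonneg d (T : measurableType d) (R : realType)
    (mu : {measure set T -> \bar R}) (D : set T) (f1 f2 : T -> \bar R) :
  (forall x, D x -> 0 <= f1 x)%E -> (forall x, D x -> f1 x <= f2 x)%E ->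
  (\int[mu]_(x in D) f1 x <= \int[mu]_(x in D) f2 x)%E.
Proof.
move=> f10 f12.
have f20 x : D x -> (0 <= f2 x)%E.
  by move=> Dx; apply: le_trans (f12 _ Dx); exact: f10.
rewrite !ge0_integralE//; apply: ereal_sup_le => _ [h hf1 <-].
exists h => // x; apply: le_trans (hf1 x) _.
by rewrite !patchE; case: ifPn => // /set_mem/f12.
Qed.

Section half_line_bounds.
Context {R : realType}.
Local Open Scope ereal_scope.
Local Notation leb := (@lebesgue_measure R).

(** [`|chi t|] is at most the integral of [b] over [0 < s <= t]; the order of
    integration is then exchanged. *)
Lemma half_line_bound (chi chi' b u : R -> R) :
  (forall t : R, is_derive t 1%R chi (chi' t)) -> continuous chi' -> chi 0%R = 0%R ->
  measurable_fun setT b -> (forall s, 0 <= b s)%R ->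
  (forall s, 0 < s -> `|chi' s| <= b s)%R ->
  measurable_fun setT u -> (forall t, 0 <= u t)%R ->
  \int[leb]_(t in `]0%R, +oo[) (u t * `|chi t|)%:E <=
  \int[leb]_(s in `]0%R, +oo[) ((b s)%:E * \int[leb]_(t in `[s, +oo[) (u t)%:E).
Proof.
move=> dchi cchi' chi0 mb b0 chib mu u0.
rewrite -(tonelli_triangle (a := EFin \o u) (b := EFin \o b)); last 4 first.
- exact/measurable_EFinP.
- exact/measurable_EFinP.
- by move=> t; rewrite lee_fin.
- by move=> t; rewrite lee_fin.
apply: le_integral_nonneg => t.
  by move=> _; rewrite lee_fin mulr_ge0.
rewrite /= in_itv/= andbT => t0; rewrite EFinM lee_wpmul2l ?lee_fin//.
have mchi' : measurable_fun setT chi' by exact: continuous_measurable_fun.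
have -> : (`|chi t|%R)%:E = `| \int[leb]_(s in `]0%R, t]) (chi' s)%:E |.
  rewrite integral_itv_obnd_cbnd; last exact/measurable_funTS/measurable_EFinP.
  by rewrite (integral_derive_segment dchi)// ?ltW// chi0 subr0.
apply: (le_trans (le_abse_integral _ _ _)) => //.
  exact/measurable_funTS/measurable_EFinP.
apply: le_integral_nonneg => s; first by [].
by rewrite /= in_itv/= => /andP[s0 _]; rewrite lee_fin chib.
Qed.

Lemma is_derive_mul (f f' g g' : R -> R) :
  (forall t : R, is_derive t 1%R f (f' t)) -> (forall t : R, is_derive t 1%R g (g' t)) ->
  forall t : R, is_derive t 1%R (fun t => f t * g t)%R (f t * g' t + g t * f' t)%R.
Proof. by move=> df dg t; have := is_deriveM (df t) (dg t). Qed.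

Lemma is_derive_pow n (t : R) :
  is_derive t 1%R (fun t => t ^+ n.+1)%R (n.+1%:R * t ^+ n)%R.
Proof.
have := @is_deriveX R R id n.+1 t 1%R 1%R (is_derive_id _ _).
by rewrite exprfctE -[(_ *: 1)%R]/(_ * 1)%R mulr1.
Qed.

Lemma continuous_exp n : continuous (fun t : R => t ^+ n)%R.
Proof. by move=> t; exact: exprn_continuous. Qed.

Lemma continuous_mul (f g : R -> R) : continuous f -> continuous g ->
  continuous (fun t => f t * g t)%R.
Proof. by move=> cf cg t; apply: cvgM; [exact: cf|exact: cg]. Qed.

Lemma continuous_add (f g : R -> R) : continuous f -> continuous g ->
  continuous (fun t => f t + g t)%R.
Proof. by move=> cf cg t; apply: cvgD; [exact: cf|exact: cg]. Qed.

Lemma continuous_norm_fun (f : R -> R) : continuous f -> continuous (fun t => `|f t|)%R.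
Proof. by move=> cf t; apply: cvg_norm; exact: cf. Qed.

Lemma measurable_norm_continuous (f : R -> R) : continuous f ->
  measurable_fun setT (fun t => `|f t|)%R.
Proof. by move=> cf; apply: continuous_measurable_fun; exact: continuous_norm_fun. Qed.

(** The case [chi t = t * phi t] of [half_line_bound]. *)
Lemma half_line_bound1 (phi phi' u V : R -> R) :
  (forall t : R, is_derive t 1%R phi (phi' t)) -> continuous phi' ->
  measurable_fun setT u -> (forall t, 0 <= u t)%R ->
  (forall s, (0 < s)%R -> \int[leb]_(t in `[s, +oo[) (u t)%:E = (V s)%:E) ->
  \int[leb]_(t in `]0%R, +oo[) (u t * `|t * phi t|)%:E <=
  \int[leb]_(s in `]0%R, +oo[) ((`|phi s| + `|s * phi' s|) * V s)%:E.
Proof.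
move=> dphi cphi' mu u0 VE.
have cphi := is_derive1_continuous dphi.
have dchi (t : R) : is_derive t 1%R (fun t => t * phi t)%R (phi t + t * phi' t)%R.
  have := is_derive_mul (fun t => @is_derive_id R R t 1%R) dphi t.
  by rewrite mulr1 addrC.
have cchi' : continuous (fun t => phi t + t * phi' t)%R.
  by apply: continuous_add => //; apply: continuous_mul => // t; exact: cvg_id.
have mb : measurable_fun setT (fun s => `|phi s| + `|s * phi' s|)%R.
  apply: continuous_measurable_fun; apply: continuous_add.
    exact: continuous_norm_fun.
  by apply/continuous_norm_fun/continuous_mul => // t; exact: cvg_id.
have b0 s : (0 <= `|phi s| + `|s * phi' s|)%R by rewrite addr_ge0.
apply: le_trans (half_line_bound dchi cchi' (mul0r _) mb b0
  (fun s _ => ler_normD _ _) mu u0) _.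
apply: le_integral_nonneg => s; rewrite /= in_itv/= andbT => s0.
  by rewrite mule_ge0 ?lee_fin ?addr_ge0//; apply: integral_ge0 => t _; rewrite lee_fin.
by rewrite VE// EFinM.
Qed.

Lemma integral_inv_sqr (s : R) : (0 < s)%R ->
  \int[leb]_(t in `[s, +oo[) (t ^- 2)%:E = (s^-1)%:E.
Proof.
move=> s0.
have dF (t : R) : (t != 0)%R -> is_derive t 1%R (fun t => - t^-1)%R (t ^- 2)%R.
  move=> t0; have := is_deriveN (is_deriveV (f := id) t0 (is_derive_id t 1%R)).
  by rewrite -[(_ *: 1)%R]/(_ * 1)%R mulr1 opprK.
rewrite (@ge0_continuous_FTC2y R (fun t => t ^- 2)%R (fun t => - t^-1)%R s 0%R).
- by rewrite sub0e -EFinN opprK.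
- by move=> t st; rewrite invr_ge0 exprn_ge0// ltW// (lt_le_trans s0).
- apply: continuous_in_subspaceT => t; rewrite inE/= in_itv/= andbT => st.
  apply: (@cvgV _ _ _ _ (fun t : R => t ^+ 2)%R);
    first by rewrite expf_neq0// gt_eqF// (lt_le_trans s0).
  exact: exprn_continuous.
- rewrite -oppr0; apply: cvgN; apply/gtr0_cvgV0.
    by near=> t; near: t; exact: nbhs_pinfty_gt.
  exact: cvg_id.
- by move=> t st; case: (dF t) => //; rewrite gt_eqF// (lt_trans s0).
- apply: cvg_at_right_filter; apply: cvgN; apply: cvgV; last exact: cvg_id.
  by rewrite gt_eqF.
- move=> t; rewrite in_itv/= andbT => st; rewrite derive1E.
  by case: (dF t) => //; rewrite gt_eqF// (lt_trans s0).
Unshelve. all: by end_near. Qed.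

(** This interpolation inequality comes from [half_line_bound] for
    [chi = t^3 phi' - 3 t^2 phi] and the weight [w t / t^2].  In
    [chi' = s^3 phi'' - 6 s phi], the factors [s^3] and [s] are what the tail [U] of
    that weight can absorb: [s * U s <= w s] because [w] decreases, and
    [s^3 * U s <= W s] because [s^3 / t^2 <= t] for [s <= t]. *)
Lemma half_line_bound2 (phi phi' phi'' w W : R -> R) :
  (forall t : R, is_derive t 1%R phi (phi' t)) ->
  (forall t : R, is_derive t 1%R phi' (phi'' t)) -> continuous phi'' ->
  measurable_fun setT w -> (forall t, 0 <= w t)%R ->
  (forall s t, 0 < s -> s <= t -> w t <= w s)%R ->
  measurable_fun setT W -> (forall t, 0 <= W t)%R ->
  (forall s, (0 < s)%R -> \int[leb]_(t in `[s, +oo[) (t * w t)%:E = (W s)%:E) ->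
  \int[leb]_(t in `]0%R, +oo[) (w t * `|t * phi' t|)%:E <=
  \int[leb]_(s in `]0%R, +oo[) (9 * (`|phi s| * w s) + `|phi'' s| * W s)%:E.
Proof.
move=> dphi dphi' cphi'' mw w0 wdecr mW W0 WE.
have cphi := is_derive1_continuous dphi.
have cphi' := is_derive1_continuous dphi'.
(* The real power is [t ^- 2] for positive [t], and measurable on the whole line. *)
pose u (t : R) := (w t * t `^ (- 2))%R.
have uE t : (0 < t)%R -> u t = (w t * t ^- 2)%R.
  by move=> t0; rewrite /u powRN powR_mulrn// ltW.
have mu : measurable_fun setT u.
  by apply: measurable_funM => //; exact: measurable_powR.
have u0 t : (0 <= u t)%R by rewrite mulr_ge0// powR_ge0.
(* The coefficient 3 makes the terms in [phi'] cancel in [chi']. *)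
pose chi (t : R) := (t ^+ 3 * phi' t - 3 * (t ^+ 2 * phi t))%R.
pose chi' (t : R) := (t ^+ 3 * phi'' t - 6 * (t * phi t))%R.
have dchi (t : R) : is_derive t 1%R chi (chi' t).
  have d1 := is_derive_mul (is_derive_pow 2) dphi' t.
  have d2 := is_deriveZ 3%R (is_derive_mul (is_derive_pow 1) dphi t).
  have := is_deriveB d1 d2; congr (is_derive _ _ _ _).
  by rewrite /chi' -[(3 *: _)%R]/(3 * _)%R; ring.
have cchi' : continuous chi'.
  apply: continuous_add; first exact/continuous_mul/cphi''/continuous_exp.
  move=> t; apply: cvgN; apply: cvgM; first exact: cvg_cst.
  by apply: cvgM; [exact: cvg_id|exact: cphi].
pose b (s : R) := (`|s| ^+ 3 * `|phi'' s| + 6 * (`|s| * `|phi s|))%R.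
have mb : measurable_fun setT b.
  apply: continuous_measurable_fun; apply: continuous_add.
    apply: continuous_mul; last exact: continuous_norm_fun.
    move=> t; apply: (@continuous_comp _ _ _ (fun t : R => `|t|%R) (fun t => t ^+ 3)%R).
      exact: norm_continuous.
    exact: exprn_continuous.
  move=> t; apply: cvgM; first exact: cvg_cst.
  by apply: cvgM; [exact: norm_continuous|exact: continuous_norm_fun].
have b0 s : (0 <= b s)%R.
  by rewrite addr_ge0// ?mulr_ge0// ?exprn_ge0// mulr_ge0.
have chib s : (0 < s)%R -> (`|chi' s| <= b s)%R.
  move=> s0; apply: le_trans (ler_normB _ _) _.
  by rewrite /b (normrM (s ^+ 3)%R) normrX (normrM 6%R) (normrM s) (ger0_norm (x := 6)%R).
have chi0 : chi 0%R = 0%R by rewrite /chi !expr0n/= !mul0r mulr0 subr0.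
pose U s := \int[leb]_(t in `[s, +oo[) (u t)%:E.
have U0 s : 0 <= U s by apply: integral_ge0 => t _; rewrite lee_fin.
have Uw s : (0 < s)%R -> s%:E * U s <= (w s)%:E.
  move=> s0; apply: (@le_trans _ _ (s%:E * ((w s)%:E * (s^-1)%:E))).
    rewrite lee_wpmul2l ?lee_fin ?(ltW s0)//.
    rewrite -integral_inv_sqr// -ge0_integralZl//; last 3 first.
    - apply/measurable_EFinP; apply: eq_measurable_fun (measurable_funTS (measurable_powR (- 2))).
      move=> t; rewrite inE/= in_itv/= andbT => st.
      by rewrite powRN powR_mulrn// ltW// (lt_le_trans s0).
    - by move=> t; rewrite /= in_itv/= andbT => st;
        rewrite lee_fin invr_ge0 exprn_ge0// ltW// (lt_le_trans s0).
    - by rewrite lee_fin.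
    rewrite /U; apply: le_integral_nonneg => t; first by move=> _; rewrite lee_fin.
    rewrite /= in_itv/= andbT => st; have t0 := lt_le_trans s0 st.
    by rewrite -EFinM lee_fin uE// ler_wpM2r ?wdecr// invr_ge0 exprn_ge0// ltW.
  by rewrite -!EFinM lee_fin mulrCA divff ?mulr1// gt_eqF.
have UW s : (0 < s)%R -> (s ^+ 3)%:E * U s <= (W s)%:E.
  move=> s0; rewrite /U -WE// -ge0_integralZl//; last 3 first.
  - exact/measurable_funTS/measurable_EFinP.
  - by move=> t _; rewrite lee_fin.
  - by rewrite lee_fin exprn_ge0// ltW.
  apply: le_integral_nonneg => t.
    by move=> _; rewrite mule_ge0 ?lee_fin// exprn_ge0// ltW.
  rewrite /= in_itv/= andbT => st; have t0 := lt_le_trans s0 st.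
  rewrite -EFinM lee_fin uE// mulrCA mulrC ler_wpM2r//.
  by rewrite ler_pdivrMr ?exprn_gt0// -exprS lerXn2r// nnegrE ltW.
have mw3 : measurable_fun setT (fun t => 3 * (`|phi t| * w t))%R.
  apply: measurable_funM => //; apply: measurable_funM => //.
  exact: measurable_norm_continuous.
apply: (@le_trans _ _ (\int[leb]_(t in `]0%R, +oo[)
    ((u t * `|chi t|)%:E + (3 * (`|phi t| * w t))%:E))).
  apply: le_integral_nonneg => t; first by move=> _; rewrite lee_fin mulr_ge0.
  rewrite /= in_itv/= andbT => t0; rewrite -EFinD lee_fin uE//.
  have -> : (w t * `|t * phi' t| = w t * t ^- 2 * `|t ^+ 3 * phi' t|)%R.
    rewrite (normrM (t ^+ 3)%R) normrX (normrM t) (ger0_norm (ltW t0)) -mulrA; congr (_ * _)%R.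
    rewrite mulrA; congr (_ * _)%R; field. by rewrite gt_eqF.
  have -> : (3 * (`|phi t| * w t) = w t * t ^- 2 * `|3 * (t ^+ 2 * phi t)|)%R.
    rewrite (normrM 3%R) (normrM (t ^+ 2)%R) normrX (ger0_norm (ltW t0)) (ger0_norm (x := 3)%R)//.
    field. by rewrite gt_eqF.
  rewrite -mulrDr ler_wpM2l ?mulr_ge0 ?invr_ge0 ?exprn_ge0 ?(ltW t0)//.
  by rewrite -lerBlDr; apply: lerB_dist.
rewrite ge0_integralD//; last 4 first.
- by move=> t _; rewrite lee_fin mulr_ge0.
- apply: measurable_funTS; apply/measurable_EFinP; apply: measurable_funM => //.
  by apply: measurable_norm_continuous; exact: is_derive1_continuous dchi.
- by move=> t _; rewrite lee_fin mulr_ge0// mulr_ge0.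
- exact/measurable_funTS/measurable_EFinP.
apply: (le_trans (leeD (half_line_bound dchi cchi' chi0 mb b0 chib mu u0) (lexx _))).
have -> : \int[leb]_(s in `]0%R, +oo[) (9 * (`|phi s| * w s) + `|phi'' s| * W s)%:E =
  \int[leb]_(s in `]0%R, +oo[) (6 * (`|phi s| * w s) + `|phi'' s| * W s)%:E +
  \int[leb]_(s in `]0%R, +oo[) (3 * (`|phi s| * w s))%:E.
  rewrite -ge0_integralD//.
  - by apply: eq_integral => s _; rewrite -EFinD; congr EFin; ring.
  - by move=> t _; rewrite lee_fin addr_ge0// mulr_ge0// mulr_ge0.
  - apply: measurable_funTS; apply/measurable_EFinP; apply: measurable_funD.
      by apply: measurable_funM => //; apply: measurable_funM => //;
        exact: measurable_norm_continuous.
    apply: measurable_funM => //.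
    exact: measurable_norm_continuous.
  - by move=> t _; rewrite lee_fin mulr_ge0// mulr_ge0.
  - exact/measurable_funTS/measurable_EFinP.
apply: leeD (lexx _); apply: le_integral_nonneg => s; rewrite /= in_itv/= andbT => s0.
  by rewrite mule_ge0 ?lee_fin//; exact: U0.
rewrite -/(U s) /b (ger0_norm (ltW s0)) EFinD ge0_muleDl ?lee_fin; last 2 first.
- by rewrite mulr_ge0// exprn_ge0// ltW.
- by rewrite !mulr_ge0// ltW.
rewrite [leRHS]EFinD addeC; apply: leeD.
- by rewrite mulrC [leRHS]EFinM (EFinM `|phi'' s|%R) -muleA lee_wpmul2l ?lee_fin// UW.
- have -> : (6 * (s * `|phi s|))%R = (6 * `|phi s| * s)%R by ring.
  by rewrite mulrA [leRHS]EFinM (EFinM (6 * `|phi s|)%R) -muleA lee_wpmul2l ?lee_fin ?mulr_ge0// Uw.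
Qed.

End half_line_bounds.

(** * Radial weights on the line *)

Section whole_line.
Context {R : realType}.
Local Open Scope ereal_scope.
Local Notation leb := (@lebesgue_measure R).

Lemma ge0_integral_fold (h : R -> \bar R) :
  measurable_fun setT h -> (forall t, 0 <= h t) ->
  \int[leb]_t h t =
  \int[leb]_(t in `]0%R, +oo[) h t + \int[leb]_(t in `]0%R, +oo[) h (- t)%R.
Proof.
move=> mh h0.
have mhN : measurable_fun setT (fun t : R => h (- t)%R) by exact: measurableT_comp.
have -> : setT = `]-oo, 0%R] `|` `]0%R, +oo[ :> set R.
  apply/seteqP; split => // t _ /=; rewrite !in_itv/= andbT.
  by have [|] := leP t 0%R; [left|right].
rewrite ge0_integral_setU//; last 2 first.
- exact: measurable_funTS.
- apply/disj_setPS => t [] /=; rewrite !in_itv/= andbT => t0.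
  by rewrite ltNge t0.
rewrite addeC; congr (_ + _).
rewrite integral_itv_obnd_cbnd; last exact: measurable_funTS.
by rewrite ge0_integration_by_substitution0//; apply: eq_integral => t _; rewrite opprK.
Qed.

Lemma integral_fold (h : R -> R) : leb.-integrable setT (EFin \o h) ->
  \int[leb]_t (h t)%:E = \int[leb]_(t in `]0%R, +oo[) (h t + h (- t)%R)%:E.
Proof.
move=> ih; have /integrableP[mp _] := ih.
have mh : measurable_fun setT h by exact/measurable_EFinP.
have ihN : leb.-integrable setT (fun t : R => (h (- t)%R)%:E).
  apply/integrableP; split; first by apply/measurable_EFinP; exact: measurableT_comp.
  have /integrableP[_] := ih; rewrite [X in X < _ -> _]ge0_integral_opp//.
  by apply: measurableT_comp => //; exact/measurable_EFinP.
have pos (k : R -> R) : leb.-integrable setT (EFin \o k) ->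
    leb.-integrable `]0%R, +oo[ (EFin \o k).
  by move=> ik; apply: integrableS ik.
transitivity (\int[leb]_(t in `]0%R, +oo[) ((h t)%:E + (h (- t)%R)%:E)); last first.
  by apply: eq_integral => t _; rewrite EFinD.
rewrite integralD//; [|exact: pos|exact: (pos (fun t => h (- t)%R))].
pose hp : R -> \bar R := EFin \o h; pose hn : R -> \bar R := EFin \o (fun t => h (- t)%R).
have -> : \int[leb]_t (h t)%:E = integral leb setT hp by [].
have -> : \int[leb]_(t in `]0%R, +oo[) (h t)%:E = integral leb `]0%R, +oo[ hp by [].
have -> : \int[leb]_(t in `]0%R, +oo[) (h (- t)%R)%:E = integral leb `]0%R, +oo[ hn by [].
rewrite [LHS]integralE [X in _ = X + _]integralE [X in _ = _ + X]integralE.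
rewrite (ge0_integral_fold (measurable_funepos mp))//.
rewrite (ge0_integral_fold (measurable_funeneg mp))//.
have fin (k : R -> R) : leb.-integrable setT (EFin \o k) ->
    \int[leb]_(t in `]0%R, +oo[) (EFin \o k)^\+ t \is a fin_num /\
    \int[leb]_(t in `]0%R, +oo[) (EFin \o k)^\- t \is a fin_num.
  move=> /pos ik; split; apply: integrable_fin_num => //.
    exact: integrable_funepos.
  exact: integrable_funeneg.
have [f1 f2] := fin _ ih; have [f3 f4] := fin (fun t => h (- t)%R) ihN.
have -> : \int[leb]_(t in `]0%R, +oo[) (EFin \o h)^\+ (- t)%R =
    \int[leb]_(t in `]0%R, +oo[) (EFin \o (fun t => h (- t)%R))^\+ t.
  by apply: eq_integral => t _; rewrite !funeposE.
have -> : \int[leb]_(t in `]0%R, +oo[) (EFin \o h)^\- (- t)%R =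
    \int[leb]_(t in `]0%R, +oo[) (EFin \o (fun t => h (- t)%R))^\- t.
  by apply: eq_integral => t _; rewrite !funenegE.
by rewrite fin_num_oppeD// addeACA.
Qed.

(** The tail integral is prescribed on the open half-line: at [0] it may diverge
    when [g] is a density generator in dimension at least 3. *)
Definition is_tail (g G : R -> R) : Prop :=
  [/\ measurable_fun setT g, measurable_fun setT G, forall x, (0 <= g x)%R,
      forall x, (0 <= G x)%R &
      forall u, (0 < u)%R -> \int[leb]_(v in `[u, +oo[) (g v)%:E = (G u)%:E].

Lemma is_tail_decr g G s t : is_tail g G -> (0 < s)%R -> (s <= t)%R -> (G t <= G s)%R.
Proof.
move=> [mg mG g0 G0 gG] s0 st; rewrite -lee_fin -!gG ?(lt_le_trans s0)//.
apply: ge0_subset_integral => //.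
- exact/measurable_funTS/measurable_EFinP.
- by move=> v _; rewrite lee_fin.
- by move=> v /=; rewrite !in_itv/= !andbT; exact: le_trans.
Qed.

(** The restriction of the spherical function [h (|z|^2 / 2)] to a line parallel to
    an axis, [r] being the contribution of the other coordinates. *)
Definition radial (h : R -> R) (r t : R) : R := h (t ^+ 2 / 2 + r)%R.

Lemma measurable_radial h r : measurable_fun setT h -> measurable_fun setT (radial h r).
Proof.
move=> mh; apply: (measurableT_comp mh); apply: measurable_funD => //.
by apply: measurable_funM => //; exact: exprn_measurable.
Qed.

Lemma radialN h r t : radial h r (- t)%R = radial h r t.
Proof. by rewrite /radial sqrrN. Qed.

Lemma is_tail_radial g G r s : is_tail g G -> (0 <= r)%R -> (0 < s)%R ->
  \int[leb]_(t in `[s, +oo[) (t * radial g r t)%:E = (radial G r s)%:E.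
Proof.
move=> [mg mG g0 G0 gG] r0 s0.
set c := (s ^+ 2 / 2 + r)%R.
have c0 : (0 < c)%R by rewrite ltr_wpDr// divr_gt0// exprn_gt0.
rewrite /radial -/c -gG//.
pose h (v : R) := ((EFin \o g) \_ `[c, +oo[) v.
have mh : measurable_fun setT h.
  by apply/(measurable_restrictT _ _).1 => //; exact/measurable_funTS/measurable_EFinP.
have h0 v : 0 <= h v by apply: erestrict_ge0 => x _; rewrite lee_fin.
have := ge0_integral_quadratic r mh h0.
have -> : \int[leb]_(v in `[r, +oo[) h v = \int[leb]_(v in `[c, +oo[) (g v)%:E.
  rewrite -integral_mkcondr; congr (integral _ _ _).
  apply/seteqP; split => v /=; rewrite !in_itv/= !andbT; first by case.
  move=> cv; split => //; apply: le_trans cv; rewrite lerDr.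
  by rewrite divr_ge0// exprn_ge0// ltW.
move=> <-.
rewrite [LHS]integral_mkcond [RHS]integral_mkcond; apply: eq_integral => t _.
rewrite !patchE; have [t0|t0] := leP 0%R t; last first.
  rewrite !memNset//= in_itv/= andbT; apply/negP; rewrite -ltNge//.
  exact: lt_trans s0.
rewrite [in RHS]mem_set/=; last by rewrite in_itv/= andbT.
rewrite /h patchE.
have -> : (t \in `[s, +oo[%classic) = ((t ^+ 2 / 2 + r)%R \in `[c, +oo[%classic).
  apply/idP/idP => /set_mem; rewrite /= in_itv/= andbT => st; apply/mem_set;
    by move: st; rewrite /= ?in_itv/= ?andbT /c lerD2r ler_pM2r ?invr_gt0// ler_sqr ?nnegrE ?(ltW s0).
by case: ifP => _; rewrite ?mul0e//= -EFinM mulrC.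
Qed.

Let weight (g : R -> R) r (t : R) : R := (`|t| * radial g r t)%R.

Let weight_ge0 g r t : (forall x, 0 <= g x)%R -> (0 <= weight g r t)%R.
Proof. by move=> g0; rewrite mulr_ge0//; exact: g0. Qed.

Let measurable_weight g r : measurable_fun setT g -> measurable_fun setT (weight g r).
Proof. by move=> mg; apply: measurable_funM => //; exact: measurable_radial. Qed.

Let weight_tail g G r s : is_tail g G -> (0 <= r)%R -> (0 < s)%R ->
  \int[leb]_(t in `[s, +oo[) (weight g r t)%:E = (radial G r s)%:E.
Proof.
move=> gG r0 s0; rewrite -(is_tail_radial gG r0 s0); apply: eq_integral => t.
rewrite inE/= in_itv/= andbT => st.
by rewrite /weight ger0_norm// ltW// (lt_le_trans s0).
Qed.

Lemma is_derive_reflect (f f' : R -> R) :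
  (forall t : R, is_derive t 1%R f (f' t)) ->
  forall t : R, is_derive t 1%R (fun t => f (- t))%R (- f' (- t))%R.
Proof.
move=> df t; have dN := is_deriveN (is_derive_id t 1%R).
have := @is_derive1_comp R f (fun t => - t)%R t (f' (- t))%R (-1)%R (df _) dN.
by rewrite mulrN1.
Qed.

Lemma continuous_reflect (f : R -> R) : continuous f -> continuous (fun t => - f (- t))%R.
Proof.
move=> cf t; apply: cvgN; apply: (@continuous_comp _ _ _ -%R f); last exact: cf.
exact: opp_continuous.
Qed.

Lemma line_bound1 g G (phi phi' : R -> R) r : is_tail g G -> (0 <= r)%R ->
  (forall t : R, is_derive t 1%R phi (phi' t)) -> continuous phi' ->
  \int[leb]_t (`|t ^+ 2 * phi t| * radial g r t)%:E <=
  \int[leb]_t ((`|phi t| + `|t * phi' t|) * radial G r t)%:E.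
Proof.
move=> gG r0 dphi cphi'; have [mg mG g0 G0 _] := gG.
have cphi := is_derive1_continuous dphi.
have mn (k : R -> R) : continuous k -> measurable_fun setT k.
  by move=> ck; exact: continuous_measurable_fun.
have mr h : measurable_fun setT h -> measurable_fun setT (radial h r).
  exact: measurable_radial.
rewrite ge0_integral_fold; last 2 first.
- apply/measurable_EFinP/measurable_funM; last exact: mr.
  apply: measurable_norm_continuous; apply: continuous_mul => //.
  exact: continuous_exp.
- by move=> t; rewrite lee_fin mulr_ge0//; exact: g0.
rewrite [leRHS]ge0_integral_fold; last 2 first.
- apply/measurable_EFinP/measurable_funM; last exact: mr.
  apply: measurable_funD; first exact: measurable_norm_continuous.
  by apply: measurable_norm_continuous; apply: continuous_mul => // t; exact: cvg_id.
- by move=> t; rewrite lee_fin mulr_ge0 ?addr_ge0//; exact: G0.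
have half (f f' : R -> R) : (forall t : R, is_derive t 1%R f (f' t)) -> continuous f' ->
    \int[leb]_(t in `]0%R, +oo[) (`|t ^+ 2 * f t| * radial g r t)%:E <=
    \int[leb]_(t in `]0%R, +oo[) ((`|f t| + `|t * f' t|) * radial G r t)%:E.
  move=> df cf'; apply: le_trans (half_line_bound1 df cf' (measurable_weight r mg)
    (fun t => weight_ge0 r t g0) (fun s s0 => weight_tail gG r0 s0)).
  apply: le_integral_nonneg => t _; first by rewrite lee_fin mulr_ge0//; exact: g0.
  by rewrite lee_fin /weight [leRHS]mulrAC -normrM mulrA -expr2.
apply: leeD; first exact: half.
under eq_integral do rewrite sqrrN radialN.
apply: le_trans (half _ _ (is_derive_reflect dphi) (continuous_reflect cphi')) _.
apply: le_integral_nonneg => t _.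
  by rewrite lee_fin mulr_ge0 ?addr_ge0//; exact: G0.
by rewrite lee_fin radialN mulrN mulNr.
Qed.

Lemma line_bound2 h g G (phi phi' phi'' : R -> R) r :
  is_tail h g -> is_tail g G -> (0 <= r)%R ->
  (forall t : R, is_derive t 1%R phi (phi' t)) ->
  (forall t : R, is_derive t 1%R phi' (phi'' t)) -> continuous phi'' ->
  \int[leb]_t (`|t * phi' t| * radial g r t)%:E <=
  \int[leb]_t (9 * (`|phi t| * radial g r t) + `|phi'' t| * radial G r t)%:E.
Proof.
move=> hg gG r0 dphi dphi' cphi''; have [mg mG g0 G0 _] := gG.
have cphi := is_derive1_continuous dphi.
have cphi' := is_derive1_continuous dphi'.
have mr k : measurable_fun setT k -> measurable_fun setT (radial k r).
  exact: measurable_radial.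
rewrite ge0_integral_fold; last 2 first.
- apply/measurable_EFinP/measurable_funM; last exact: mr.
  by apply: measurable_norm_continuous; apply: continuous_mul => // t; exact: cvg_id.
- by move=> t; rewrite lee_fin mulr_ge0//; exact: g0.
rewrite [leRHS]ge0_integral_fold; last 2 first.
- apply/measurable_EFinP/measurable_funD; apply: measurable_funM => //;
    try exact: mr; try exact: measurable_norm_continuous.
  apply: measurable_funM => //; last exact: mr.
  exact: measurable_norm_continuous.
- by move=> t; rewrite lee_fin addr_ge0 ?mulr_ge0//; [exact: g0|exact: G0].
have half (f f' f'' : R -> R) : (forall t : R, is_derive t 1%R f (f' t)) ->
    (forall t : R, is_derive t 1%R f' (f'' t)) -> continuous f'' ->
    \int[leb]_(t in `]0%R, +oo[) (`|t * f' t| * radial g r t)%:E <=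
    \int[leb]_(t in `]0%R, +oo[) (9 * (`|f t| * radial g r t) + `|f'' t| * radial G r t)%:E.
  move=> df df' cf''.
  have decr s t : (0 < s)%R -> (s <= t)%R -> (radial g r t <= radial g r s)%R.
    move=> s0 st; apply: (is_tail_decr hg).
      by rewrite ltr_wpDr// divr_gt0// exprn_gt0.
    by rewrite lerD2r ler_pM2r ?invr_gt0// ler_sqr ?nnegrE ?(ltW s0)// ltW// (lt_le_trans s0).
  apply: le_trans (half_line_bound2 df df' cf'' (mr _ mg) (fun t => g0 _) decr
    (mr _ mG) (fun t => G0 _) (fun s s0 => is_tail_radial gG r0 s0)).
  apply: le_integral_nonneg => t _; first by rewrite lee_fin mulr_ge0//; exact: g0.
  by rewrite lee_fin mulrC.
apply: leeD; first exact: half.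
under eq_integral do rewrite radialN.
have df2 (t : R) : is_derive t 1%R (fun t => - phi' (- t))%R (phi'' (- t))%R.
  by have := is_deriveN (is_derive_reflect dphi' t); rewrite opprK.
have cf2 : continuous (fun t => phi'' (- t))%R.
  move=> t; apply: (@continuous_comp _ _ _ (fun t : R => - t)%R phi''); last exact: cphi''.
  exact: opp_continuous.
apply: le_trans (le_trans _ (half _ _ _ (is_derive_reflect dphi) df2 cf2)) _.
  apply: le_integral_nonneg => t _; first by rewrite lee_fin mulr_ge0//; exact: g0.
  by rewrite lee_fin mulrN mulNr.
by apply: le_integral_nonneg => t _; rewrite lee_fin ?radialN// addr_ge0 ?mulr_ge0//;
  [exact: g0|exact: G0].
Qed.

(** The odd part [psi t - psi (- t)] vanishes at [0], so [half_line_by_parts]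
    applies to it; the even part of [psi] contributes to neither side. *)
Lemma line_by_parts g G (psi psi' : R -> R) r : is_tail g G -> (0 <= r)%R ->
  (forall t : R, is_derive t 1%R psi (psi' t)) -> continuous psi' ->
  leb.-integrable setT (fun t => (t * psi t * radial g r t)%:E) ->
  leb.-integrable setT (fun t => (psi' t * radial G r t)%:E) ->
  \int[leb]_t (t * psi t * radial g r t)%:E = \int[leb]_t (psi' t * radial G r t)%:E.
Proof.
move=> gG r0 dpsi cpsi' i1 i2; have [mg mG g0 G0 _] := gG.
rewrite (integral_fold i1) (integral_fold i2).
pose chi (t : R) := (psi t - psi (- t))%R.
pose chi' (t : R) := (psi' t - - psi' (- t))%R.
have dchi (t : R) : is_derive t 1%R chi (chi' t).
  exact: is_deriveB (dpsi t) (is_derive_reflect dpsi t).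
have cchi' : continuous chi'.
  by move=> t; apply: cvgB; [exact: cpsi'|exact: continuous_reflect].
have chi0 : chi 0%R = 0%R by rewrite /chi oppr0 subrr.
transitivity (\int[leb]_(t in `]0%R, +oo[) (weight g r t * chi t)%:E).
  apply: eq_integral => t; rewrite inE/= in_itv/= andbT => t0.
  rewrite radialN /weight ger0_norm ?(ltW t0)// /chi; congr EFin; ring.
rewrite (half_line_by_parts dchi cchi' chi0 (measurable_weight r mg)
  (fun t => weight_ge0 r t g0) (fun s s0 => weight_tail gG r0 s0)).
  by apply: eq_integral => t _; rewrite radialN /chi'; congr EFin; ring.
have /integrableP[mi2] := i2; apply: le_lt_trans.
rewrite ge0_integral_fold//; last exact: measurableT_comp.
rewrite -ge0_integralD//; last 2 first.
- by apply: measurable_funTS; exact: measurableT_comp.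
- apply: measurable_funTS; apply: measurableT_comp => //.
  exact: (measurableT_comp mi2).
apply: le_integral_nonneg => t _; first by rewrite lee_fin mulr_ge0//; exact: G0.
rewrite /= -EFinD lee_fin radialN !normrM (ger0_norm (G0 _)) -mulrDl.
by rewrite ler_wpM2r//; [exact: G0|rewrite /chi' opprK ler_normD].
Qed.

End whole_line.

(** * Spherical weights on R^n *)

Section space.
Context {R : realType}.
Local Open Scope ereal_scope.
Local Notation leb := (@lebesgue_measure R).

Definition half_sqnorm n (z : 'cV[R]_n) : R := (2^-1 * (z^T *m z) ord0 ord0)%R.

Lemma half_sqnormE n (z : 'cV[R]_n) :
  half_sqnorm z = (2^-1 * \sum_i z i ord0 ^+ 2)%R.
Proof.
rewrite /half_sqnorm mxE; congr (_ * _)%R; apply: eq_bigr => i _.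
by rewrite mxE expr2.
Qed.

Lemma half_sqnorm_ge0 n (z : 'cV[R]_n) : (0 <= half_sqnorm z)%R.
Proof. by rewrite half_sqnormE mulr_ge0// sumr_ge0// => i _; exact: sqr_ge0. Qed.

Lemma half_sqnorm_coord n (i : 'I_n) (z : 'cV[R]_n) t :
  half_sqnorm (set_coord i z t) = (t ^+ 2 / 2 + half_sqnorm (set_coord i z 0))%R.
Proof.
rewrite !half_sqnormE (bigD1 i)//= [in RHS](bigD1 i)//= !mxE eqxx expr0n/= add0r.
rewrite mulrDr mulrC; congr (_ + _ * _)%R; apply: eq_bigr => j ji.
by rewrite !mxE (negbTE ji).
Qed.

Lemma set_coordE n (i : 'I_n) (z : 'cV[R]_n) t :
  set_coord i z t = (set_coord i z 0 + t *: delta_mx i ord0)%R.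
Proof.
apply/colP => j; rewrite !mxE eqxx andbT; case: eqVneq => _ /=.
  by rewrite mulr1 add0r.
by rewrite mulr0 addr0.
Qed.

Lemma is_derive_coord n (i : 'I_n) (F : 'cV[R]_n -> R) z : C1 F ->
  forall t : R, is_derive t 1%R (fun s => F (set_coord i z s))
    (partial i F (set_coord i z t)).
Proof.
move=> FC1 t; rewrite set_coordE.
have -> : (fun s : R => F (set_coord i z s)) =
    (fun s => F (set_coord i z 0 + s *: (delta_mx i ord0 : 'cV[R]_n)))%R.
  by apply/funext => s; rewrite set_coordE.
by apply: is_derive_line; exact: (FC1 i).1.
Qed.

Lemma continuous_coord n (i : 'I_n) (F : 'cV[R]_n -> R) z :
  continuous F -> continuous (fun t => F (set_coord i z t)).
Proof.
move=> cF t; apply: (@continuous_comp _ _ _ (set_coord i z) F); last exact: cF.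
apply: cvg_cV => j; rewrite mxE; under eq_fun do rewrite mxE.
by case: ifP => _; [exact: cvg_id|exact: cvg_cst].
Qed.

Lemma measurable_half_sqnorm n (g : R -> R) : measurable_fun setT g ->
  measurable_fun setT (fun z : 'cV[R]_n => g (half_sqnorm z)).
Proof.
move=> mg; apply: (measurableT_comp mg).
rewrite [X in measurable_fun _ X](_ : _ = (fun z : 'cV[R]_n => 2^-1 * \sum_i z i ord0 ^+ 2)%R);
  last by apply/funext => z; exact: half_sqnormE.
apply: measurable_funM => //; apply: measurable_sum => i.
by apply: (@measurableT_comp _ _ _ _ _ _ (fun x : R => x ^+ 2)%R) => //;
  exact: measurable_entry.
Qed.

Lemma coord_bound1 n (i : 'I_n) g G (F : 'cV[R]_n -> R) : is_tail g G -> C1 F ->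
  \int[lebesgue_cV n]_z (`|z i ord0 ^+ 2 * F z| * g (half_sqnorm z))%:E <=
  \int[lebesgue_cV n]_z
    ((`|F z| + `|z i ord0 * partial i F z|) * G (half_sqnorm z))%:E.
Proof.
move=> gG FC1; have [mg mG g0 G0 _] := gG.
have cF := C1_continuous FC1.
have mF := continuous_measurable_cV cF.
have mdF := continuous_measurable_cV (FC1 i).2.
apply: (le_integral_coord (i := i)).
- apply/measurable_EFinP/measurable_funM; last exact: measurable_half_sqnorm.
  apply: measurableT_comp => //; apply: measurable_funM => //.
  apply: (@measurableT_comp _ _ _ _ _ _ (fun x : R => x ^+ 2)%R) => //.
  exact: measurable_entry.
- apply/measurable_EFinP/measurable_funM; last exact: measurable_half_sqnorm.
  apply: measurable_funD; apply: measurableT_comp => //.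
  by apply: measurable_funM => //; exact: measurable_entry.
- by move=> z; rewrite lee_fin mulr_ge0.
- by move=> z; rewrite lee_fin mulr_ge0// addr_ge0.
move=> z; have := line_bound1 gG (half_sqnorm_ge0 (set_coord i z 0%R))
  (is_derive_coord i z FC1) (continuous_coord (FC1 i).2).
by congr (_ <= _); apply: eq_integral => t _;
  rewrite (half_sqnorm_coord i z t) ?[set_coord i z t i ord0]mxE ?eqxx.
Qed.

Lemma coord_bound2 n (i : 'I_n) h g G (F : 'cV[R]_n -> R) :
  is_tail h g -> is_tail g G -> C2 F ->
  \int[lebesgue_cV n]_z (`|z i ord0 * partial i F z| * g (half_sqnorm z))%:E <=
  \int[lebesgue_cV n]_z (9 * (`|F z| * g (half_sqnorm z)) +
    `|partial i (partial i F) z| * G (half_sqnorm z))%:E.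
Proof.
move=> hg gG [FC1 FC2]; have [mg mG g0 G0 _] := gG.
have mF := continuous_measurable_cV (C1_continuous FC1).
have mdF := continuous_measurable_cV (FC1 i).2.
have mddF := continuous_measurable_cV (FC2 i i).2.
have mhs k := @measurable_half_sqnorm n k.
apply: (le_integral_coord (i := i)).
- apply/measurable_EFinP/measurable_funM; last exact: mhs.
  apply: measurableT_comp => //; apply: measurable_funM => //.
  exact: measurable_entry.
- apply/measurable_EFinP/measurable_funD; apply: measurable_funM => //;
    try exact: mhs; try exact: measurableT_comp.
  by apply: measurable_funM; [exact: measurableT_comp|exact: mhs].
- by move=> z; rewrite lee_fin mulr_ge0.
- by move=> z; rewrite lee_fin addr_ge0// !mulr_ge0.
move=> z; have := line_bound2 hg gG (half_sqnorm_ge0 (set_coord i z 0%R))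
  (is_derive_coord i z FC1) (is_derive_coord i z (FC2 i)) (continuous_coord (FC2 i i).2).
by congr (_ <= _); apply: eq_integral => t _;
  rewrite (half_sqnorm_coord i z t) ?[set_coord i z t i ord0]mxE ?eqxx.
Qed.

Lemma integrable_cV_cons n (h : 'cV[R]_n.+1 -> \bar R) :
  (lebesgue_cV n.+1).-integrable setT h ->
  (leb \x lebesgue_cV n).-integrable setT (h \o @cV_cons R n) /\
  \int[lebesgue_cV n.+1]_x h x =
    \int[lebesgue_cV n]_y \int[leb]_t h (cV_cons (t, y)).
Proof.
move=> ih; have mcons := @measurable_cV_cons R n; have /integrableP[mh hoo] := ih.
have ihc : (leb \x lebesgue_cV n).-integrable setT (h \o @cV_cons R n).
  apply/integrableP; split; first exact: measurableT_comp.
  move: hoo.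
  have -> : \int[lebesgue_cV n.+1]_x `|h x| =
      \int[pushforward (leb \x lebesgue_cV n) (@cV_cons R n)]_x `|h x| by [].
  by rewrite ge0_integral_pushforward//; exact: measurableT_comp.
split=> //.
rewrite (integral21_prod_meas1 ihc).
have -> : \int[lebesgue_cV n.+1]_x h x =
  \int[pushforward (leb \x lebesgue_cV n) (@cV_cons R n)]_x h x by [].
by rewrite integral_pushforward.
Qed.

(** Fubini's theorem reduces the identity to [line_by_parts] on almost every line
    parallel to the first axis. *)
Lemma space_by_parts n g G (F : 'cV[R]_n.+1 -> R) : is_tail g G -> C1 F ->
  (lebesgue_cV n.+1).-integrable setT
    (fun z => (z ord0 ord0 * F z * g (half_sqnorm z))%:E) ->
  (lebesgue_cV n.+1).-integrable setT
    (fun z => (partial ord0 F z * G (half_sqnorm z))%:E) ->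
  \int[lebesgue_cV n.+1]_z (z ord0 ord0 * F z * g (half_sqnorm z))%:E =
  \int[lebesgue_cV n.+1]_z (partial ord0 F z * G (half_sqnorm z))%:E.
Proof.
move=> gG FC1 i1 i2; have [ic1 E1] := integrable_cV_cons i1.
have [ic2 E2] := integrable_cV_cons i2; rewrite E1 E2.
apply: ae_eq_integral => //.
- exact: measurable_fubini_G ic1.
- exact: measurable_fubini_G ic2.
have := ae_integrable2 ic1; have := ae_integrable2 ic2; apply: filterS2 => y j2 j1 _.
have lineE (t : R) : cV_cons (t, y) = set_coord ord0 (cV_cons (0%R, y)) t.
  by rewrite set_coord0_cons.
pose q := half_sqnorm (set_coord ord0 (cV_cons (0%R, y)) 0%R).
pose phi (t : R) := F (set_coord ord0 (cV_cons (0%R, y)) t).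
pose phi' (t : R) := partial ord0 F (set_coord ord0 (cV_cons (0%R, y)) t).
have e1 : (fun t : R => (cV_cons (t, y) ord0 ord0 * F (cV_cons (t, y)) *
    g (half_sqnorm (cV_cons (t, y))))%:E) = (fun t => (t * phi t * radial g q t)%:E).
  by apply/funext => t; rewrite cV_cons0 lineE half_sqnorm_coord.
have e2 : (fun t : R => (partial ord0 F (cV_cons (t, y)) *
    G (half_sqnorm (cV_cons (t, y))))%:E) = (fun t => (phi' t * radial G q t)%:E).
  by apply/funext => t; rewrite lineE half_sqnorm_coord.
rewrite e1 e2; apply: (line_by_parts gG (half_sqnorm_ge0 _) (is_derive_coord _ _ FC1)
  (continuous_coord (FC1 ord0).2)).
- by rewrite -[X in _.-integrable _ X]e1.
- by rewrite -[X in _.-integrable _ X]e2.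
Qed.

End space.

(** * Density generators and their tails *)

Section generators.
Context {R : realType}.
Local Open Scope ereal_scope.
Local Notation leb := (@lebesgue_measure R).

(** A density generator is only constrained on the nonnegative reals; extending it
    by zero makes it measurable and nonnegative everywhere. *)
Definition on_half_line (g : R -> R) : R -> R := g \_ `[0%R, +oo[.

Lemma on_half_lineE g t : (0 <= t)%R -> on_half_line g t = g t.
Proof. by move=> t0; rewrite /on_half_line patchE mem_set//= in_itv/= andbT. Qed.

Lemma on_half_line_ge0 n g t : density_generator n g -> (0 <= on_half_line g t)%R.
Proof.
move=> [_ g0 _]; rewrite /on_half_line patchE; case: ifPn => // /set_mem/=.
by rewrite in_itv/= andbT; exact: g0.
Qed.

Lemma measurable_on_half_line n g :
  density_generator n g -> measurable_fun setT (on_half_line g).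
Proof. by move=> [mg _ _]; apply/(measurable_restrictT _ _).1. Qed.

(** An infinite integral counts as 0 in [cumulative_generator], so a cumulative
    generator of positive mass has a finite tail from some point on.  Before that
    point, the finite mass of [g] bounds its integral because the power of [t] in
    [generator_mass] is bounded below on compact subsets of the positive reals. *)
Lemma generator_tail_finite n g u : density_generator n g ->
  density_generator n (cumulative_generator g) -> (0 < u)%R ->
  \int[leb]_(v in `[u, +oo[) (g v)%:E < +oo.
Proof.
move=> [mg g0 /andP[_ gfin]] [_ _ /andP[Gpos _]] u0.
have mgS (D : set R) : measurable D -> D `<=` `[0%R, +oo[ ->
    measurable_fun D (fun v => (g v)%:E).
  by move=> mD D0; apply/measurable_EFinP; exact: measurable_funS mg.
have [w w0 wfin] : exists2 w, (0 <= w)%R & \int[leb]_(v in `[w, +oo[) (g v)%:E < +oo.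
  apply: contrapT => /forall2NP h; move: Gpos; apply/negP; rewrite -leNgt.
  rewrite /generator_mass le_eqVlt; apply/orP; left; apply/eqP.
  apply: integral0_eq => t; rewrite /= in_itv/= andbT => t0.
  have [//|/negP] := h t; rewrite -leNgt leye_eq => /eqP H.
  by rewrite /cumulative_generator /Rintegral H mulr0.
have [wu|uw] := leP w u.
  apply: le_lt_trans wfin; apply: ge0_subset_integral => //.
  - by apply: mgS => // v /=; rewrite !in_itv/= !andbT; exact: le_trans.
  - by move=> v /=; rewrite in_itv/= andbT => wv; rewrite lee_fin g0// (le_trans w0).
  - by move=> v /=; rewrite !in_itv/= !andbT; exact: le_trans.
have -> : `[u, +oo[%classic = `[u, w[ `|` `[w, +oo[ :> set R.
  apply/seteqP; split => v /=; rewrite !in_itv/= !andbT.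
    by move=> ->; have [|] := ltP v w; [left|right].
  by case=> [/andP[]//|]; apply: le_trans; exact: ltW.
rewrite ge0_integral_setU//; last 3 first.
- apply: mgS; first exact: measurableU.
  move=> v [] /=; rewrite !in_itv/= !andbT; last exact: le_trans.
  by move=> /andP[uv _]; rewrite (le_trans (ltW u0)).
- move=> v [] /=; rewrite !in_itv/= ?andbT => H; rewrite lee_fin g0//.
    by move/andP: H => [uv _]; rewrite (le_trans (ltW u0)).
  exact: le_trans H.
- apply/disj_setPS => v [] /=; rewrite !in_itv/= andbT => /andP[_ vw].
  by rewrite leNgt vw.
rewrite lte_add_pinfty//.
set p : R := (n%:R / 2 - 1)%R.
have [m m0 mp] : exists2 m : R, (0 < m)%R & forall t, (u <= t < w)%R -> (m <= t `^ p)%R.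
  have [p0|p0] := leP 0%R p.
    exists (u `^ p)%R; first exact: powR_gt0.
    by move=> t /andP[ut _]; rewrite ge0_ler_powR// nnegrE ?(ltW u0)// (le_trans (ltW u0)).
  have w00 : (0 < w)%R := lt_trans u0 uw.
  exists (w `^ p)%R; first exact: powR_gt0.
  move=> t /andP[ut tw]; have t0 := lt_le_trans u0 ut.
  rewrite -(opprK p) !(powRN _ (- p)) lef_pV2 ?posrE ?powR_gt0//.
  by rewrite ge0_ler_powR ?nnegrE ?(ltW t0) ?(ltW w00) ?(ltW tw)// oppr_ge0 ltW.
have sub : `[u, w[ `<=` `[0%R, +oo[.
  by move=> v /=; rewrite !in_itv/= andbT => /andP[uv _]; rewrite (le_trans (ltW u0)).
have H : m%:E * \int[leb]_(v in `[u, w[) (g v)%:E <= generator_mass n g.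
  rewrite -ge0_integralZl//; last 3 first.
  - exact: mgS.
  - by move=> v /sub; rewrite /= in_itv/= andbT => v0; rewrite lee_fin g0.
  - by rewrite lee_fin ltW.
  rewrite /generator_mass; apply: (@le_trans _ _ (\int[leb]_(t in `[u, w[) (t `^ p * g t)%:E)).
    apply: le_integral_nonneg => v.
      by move=> /sub; rewrite /= in_itv/= andbT => v0; rewrite mule_ge0 ?lee_fin ?g0// ltW.
    move=> uvw; have /sub := uvw; rewrite /= in_itv/= andbT => v0.
    by rewrite -EFinM lee_fin ler_wpM2r ?g0// mp.
  apply: ge0_subset_integral => //.
  - apply/measurable_EFinP/measurable_funM => //.
    by apply: measurable_funTS; exact: measurable_powR.
  - by move=> v /=; rewrite in_itv/= andbT => v0; rewrite lee_fin mulr_ge0 ?powR_ge0 ?g0.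
rewrite ltNge leye_eq; apply/negP => /eqP Hoo; move: H; rewrite Hoo.
by rewrite gt0_muley ?lte_fin// leye_eq => /eqP E; rewrite E in gfin.
Qed.

Lemma generator_is_tail n g : density_generator n g ->
  density_generator n (cumulative_generator g) ->
  is_tail (on_half_line g) (on_half_line (cumulative_generator g)).
Proof.
move=> gg gG; split.
- exact: measurable_on_half_line gg.
- exact: measurable_on_half_line gG.
- by move=> x; exact: on_half_line_ge0 gg.
- by move=> x; exact: on_half_line_ge0 gG.
move=> u u0; rewrite on_half_lineE ?ltW//.
transitivity (\int[leb]_(v in `[u, +oo[) (g v)%:E).
  apply: eq_integral => v; rewrite inE/= in_itv/= andbT => uv.
  by rewrite on_half_lineE// (le_trans (ltW u0)).
rewrite /cumulative_generator /Rintegral fineK// ge0_fin_numE.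
  exact: generator_tail_finite gg gG u0.
apply: integral_ge0 => v; rewrite /= in_itv/= andbT => uv; case: gg => _ g0 _.
by rewrite lee_fin g0// (le_trans (ltW u0)).
Qed.

Lemma normalizing_constant_ge0 n (g : R -> R) : density_generator n g ->
  (0 <= normalizing_constant n g)%R.
Proof.
move=> [_ g0 _]; rewrite /normalizing_constant !mulr_ge0 ?invr_ge0 ?powR_ge0//.
  apply: Rintegral_ge0 => t /=; rewrite in_itv/= andbT => t0.
  by rewrite mulr_ge0 ?powR_ge0 ?expR_ge0.
apply: fine_ge0; apply: integral_ge0 => t; rewrite /= in_itv/= andbT => t0.
by rewrite lee_fin mulr_ge0 ?powR_ge0 ?g0.
Qed.

End generators.

(** * Standardization of elliptical distributions *)

Section standardization.
Context {R : realType}.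
Variables (n : nat) (S A : 'M[R]_n).
Hypothesis SA : cholesky_factor S A.

Lemma cholesky_det_gt0 : 0 < \det A.
Proof. by case: SA => tA A0 _; rewrite det_trig// prodr_gt0. Qed.

Lemma cholesky_unit : A \in unitmx.
Proof. by rewrite unitmxE unitfE gt_eqF// cholesky_det_gt0. Qed.

Lemma cholesky_sqrt_det : Num.sqrt (\det S) = \det A.
Proof.
case: SA => _ _ <-; rewrite det_mulmx det_tr -expr2 sqrtr_sqr ger0_norm//.
exact/ltW/cholesky_det_gt0.
Qed.

Lemma cholesky_whitening : A^T *m invmx S *m A = 1%:M.
Proof.
have uA := cholesky_unit; case: SA => _ _ ES.
have -> : A^T = invmx A *m S by rewrite -ES mulKmx.
rewrite -(mulmxA (invmx A)) mulmxV ?mulmx1 ?mulVmx//.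
by rewrite -ES unitmx_mul unitmx_tr uA.
Qed.

Lemma elliptical_pdf_affine (mu : 'cV[R]_n) g (z : 'cV[R]_n) :
  elliptical_pdf mu S g (A *m z + mu) =
  normalizing_constant n g / \det A * g (half_sqnorm z).
Proof.
rewrite /elliptical_pdf cholesky_sqrt_det addrK trmx_mul -!mulmxA (mulmxA (invmx S)).
by rewrite (mulmxA A^T) (mulmxA A^T) cholesky_whitening mul1mx.
Qed.

End standardization.

Section transfer.
Context {R : realType}.
Local Open Scope ereal_scope.
Variables (n : nat) (d : measure_display) (T : measurableType d) (P : probability T R).
Variables (X : {RV P >-> 'cV[R]_n}) (mu : 'cV[R]_n) (S A : 'M[R]_n) (g : R -> R).
Hypotheses (gg : density_generator n g) (SA : cholesky_factor S A).
Hypothesis X_ell : elliptical X mu S g.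

Local Notation c := (normalizing_constant n g).
Local Notation g0 := (on_half_line g).

Let c0 : (0 <= c)%R := normalizing_constant_ge0 gg.

Let pdfE x : elliptical_pdf mu S g x =
  (c / \det A * g0 (half_sqnorm (invmx A *m x + - (invmx A *m mu))))%R.
Proof.
rewrite -{1}(subrK mu x) -[(x - mu)%R](mulKVmx (cholesky_unit SA)).
rewrite (elliptical_pdf_affine SA) mulmxBr on_half_lineE//; exact: half_sqnorm_ge0.
Qed.

Let mpdf : measurable_fun setT (elliptical_pdf mu S g).
Proof.
rewrite (funext pdfE); apply: measurable_funM => //.
have mh := @measurable_half_sqnorm R n _ (measurable_on_half_line gg).
exact: (measurableT_comp mh (measurable_affine _ _)).
Qed.

Let pdf_ge0 x : (0 <= elliptical_pdf mu S g x)%R.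
Proof.
rewrite pdfE mulr_ge0 ?(on_half_line_ge0 _ gg)// divr_ge0// ltW//.
exact: cholesky_det_gt0 SA.
Qed.

(** The determinant produced by the substitution [x = A z + mu] cancels the one in
    the density. *)
Lemma ge0_expectation_elliptical (k : 'cV[R]_n -> \bar R) :
  measurable_fun setT k -> (forall x, 0 <= k x) ->
  \int[P]_w k (X w) =
  \int[lebesgue_cV n]_z (k (A *m z + mu)%R * (c * g0 (half_sqnorm z))%:E).
Proof.
move=> mk k0; have [tA A0 _] := SA; have dA := cholesky_det_gt0 SA.
rewrite -(ge0_integral_distribution X mk k0).
rewrite (ge0_integral_density mpdf pdf_ge0 X_ell mk k0).
have mkp : measurable_fun setT (fun x => k x * (elliptical_pdf mu S g x)%:E).
  by apply: emeasurable_funM => //; exact/measurable_EFinP.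
have kp0 x : 0 <= k x * (elliptical_pdf mu S g x)%:E by rewrite mule_ge0// lee_fin.
rewrite (ge0_integral_trig mu tA A0 mkp kp0) -ge0_integralZl//; last 2 first.
- by apply: (measurableT_comp mkp); exact: measurable_affine.
- by rewrite lee_fin ltW.
apply: eq_integral => z _; rewrite (elliptical_pdf_affine SA) muleCA; congr (_ * _).
rewrite -EFinM on_half_lineE; last exact: half_sqnorm_ge0.
by congr EFin; field; rewrite gt_eqF.
Qed.

(** Positive and negative parts are treated separately, so that the equality holds
    with the conventions on infinite integrals and does not presuppose
    integrability. *)
Lemma expectation_elliptical (k : 'cV[R]_n -> R) : measurable_fun setT k ->
  'E_P[fun w => k (X w)] =
  \int[lebesgue_cV n]_z (k (A *m z + mu) * (c * g0 (half_sqnorm z)))%:E.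
Proof.
move=> mk; have mk' : measurable_fun setT (EFin \o k) by exact/measurable_EFinP.
have w0 z : (0 <= c * g0 (half_sqnorm z))%R.
  by rewrite mulr_ge0// (on_half_line_ge0 _ gg).
rewrite unlock integralE [RHS]integralE; congr (_ - _).
  transitivity (\int[P]_w (EFin \o k)^\+ (X w)).
    by apply: eq_integral => w _; rewrite !funeposE.
  rewrite ge0_expectation_elliptical//; last exact: measurable_funepos.
  apply: eq_integral => z _; rewrite !funeposE/=.
  by rewrite [in RHS]EFinM maxe_pMl ?mul0e ?lee_fin.
transitivity (\int[P]_w (EFin \o k)^\- (X w)).
  by apply: eq_integral => w _; rewrite !funenegE.
rewrite ge0_expectation_elliptical//; last exact: measurable_funeneg.
apply: eq_integral => z _; rewrite !funenegE/=.
by rewrite -mulNr [in RHS]EFinM maxe_pMl ?mul0e ?lee_fin.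
Qed.

(** The density integrates to 1, hence cannot be identically zero. *)
Lemma normalizing_constant_neq0 : c != 0%R.
Proof.
apply/negP => /eqP c_eq0.
have := ge0_expectation_elliptical (k := cst 1) (measurable_cst _) (fun=> lee01).
have -> : \int[P]_w cst 1 (X w) = 1.
  by rewrite (integral_cst P measurableT) mul1e; exact: probability_setT.
under eq_integral do rewrite c_eq0 mul0r mule0.
by rewrite integral0 => /eqP; rewrite onee_eq0.
Qed.

Lemma integrable_elliptical (k : 'cV[R]_n -> R) : measurable_fun setT k ->
  P.-integrable setT (fun w => (k (X w))%:E) ->
  (lebesgue_cV n).-integrable setT (fun z => (k (A *m z + mu) * g0 (half_sqnorm z))%:E).
Proof.
move=> mk /integrableP[_ koo]; 
have mkg : measurable_fun setT
    (fun z : 'cV[R]_n => k (A *m z + mu) * g0 (half_sqnorm z))%R.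
  apply: measurable_funM; last first.
    by apply: measurable_half_sqnorm; exact: measurable_on_half_line gg.
  exact: (measurableT_comp mk (measurable_affine A mu)).
apply/integrableP; split; first exact/measurable_EFinP.
have c_gt0 : (0 < c)%R by rewrite lt_neqAle eq_sym normalizing_constant_neq0.
move: koo; rewrite (@ge0_expectation_elliptical (fun x => `|k x|%R%:E))//; last first.
  by apply/measurable_EFinP; exact: measurableT_comp.
have w0 (z : 'cV[R]_n) : (0 <= g0 (half_sqnorm z))%R by rewrite (on_half_line_ge0 _ gg).
have E z : `|k (A *m z + mu)|%R%:E * (c * g0 (half_sqnorm z))%:E =
    c%:E * `|(k (A *m z + mu) * g0 (half_sqnorm z))%:E|.
  by rewrite -EFinM/= normrM (ger0_norm (w0 z)) -EFinM mulrCA.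
under eq_integral do rewrite E.
rewrite ge0_integralZl//; last first.
  exact: (measurableT_comp (@abse_measurable R setT) (proj2 (measurable_EFinP _ _) mkg)).
rewrite !ltey; apply: contra => /eqP ->.
by rewrite gt0_muley ?lte_fin.
Qed.

End transfer.

(** * Moments of spherical weights *)

Lemma Rintegral_EFin d (T : measurableType d) (R : realType)
    (m : {measure set T -> \bar R}) (h : T -> R) :
  m.-integrable setT (EFin \o h) ->
  (\int[m]_x (h x)%:E)%E = (\int[m]_x h x)%:E.
Proof. by move=> ih; rewrite /Rintegral fineK//; exact: integrable_fin_num. Qed.

Lemma integrable_lincomb d (T : measurableType d) (R : realType)
    (m : {measure set T -> \bar R}) (I : Type) (r : seq I) (c : I -> R) (h : I -> T -> R) :
  (forall i, m.-integrable setT (EFin \o h i)) ->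
  m.-integrable setT (EFin \o (fun x => \sum_(i <- r) c i * h i x)) /\
  \int[m]_x (\sum_(i <- r) c i * h i x) = \sum_(i <- r) c i * \int[m]_x h i x.
Proof.
move=> ih.
have iZ i : m.-integrable setT (EFin \o (fun x => c i * h i x)).
  by apply: (integrableZl measurableT (c i) (ih i)).
elim: r => [|i r [IHi IHe]].
  have -> : (fun x => \sum_(i <- [::]) c i * h i x) = cst 0.
    by apply/funext => x; rewrite big_nil.
  rewrite big_nil; split; first exact: integrable0.
  by rewrite /Rintegral integral0.
have E : (fun x => \sum_(j <- i :: r) c j * h j x) =
    (fun x => c i * h i x + \sum_(j <- r) c j * h j x).
  by apply/funext => x; rewrite big_cons.
rewrite E; split; first exact: (integrableD measurableT (iZ i) IHi).
by rewrite RintegralD// IHe big_cons RintegralZl.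
Qed.

Section products.
Context {R : realType} (n : nat).

Lemma C1_coord (i : 'I_n) : C1 (fun z : 'cV[R]_n => z i ord0) /\
  forall j, partial j (fun z : 'cV[R]_n => z i ord0) = cst (j == i)%:R.
Proof.
have D j z : is_derive z (delta_mx j ord0) (fun z : 'cV[R]_n => z i ord0) (j == i)%:R.
  have H : h^-1 *: (((fun z : 'cV[R]_n => z i ord0) \o shift z)
      (h *: (delta_mx j ord0 : 'cV[R]_n)) - z i ord0) @[h --> (0:R)^'] --> ((j == i)%:R : R).
    apply: (@cvg_trans _ (((j == i)%:R : R) @[h --> (0:R)^'])); last exact: cvg_cst.
    apply: near_eq_cvg; near=> h.
    rewrite /= !mxE addrK eqxx andbT -[_ *: _]/(h^-1 * (h * _)) mulrA mulVf ?mul1r 1?(eq_sym i)//.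
    by near: h; exact: nbhs_dnbhs_neq.
  by split; [exact: cvgP H|exact: cvg_lim H].
have E j : partial j (fun z : 'cV[R]_n => z i ord0) = cst (j == i)%:R.
  by apply/funext => z; case: (D j z).
split => // j; split => [z|]; first by case: (D j z).
by rewrite E; exact: cst_continuous.
Unshelve. all: by end_near. Qed.

Lemma C1_mul (F G : 'cV[R]_n -> R) : C1 F -> C1 G ->
  C1 (fun z => F z * G z) /\ forall i, partial i (fun z => F z * G z) =
    (fun z => F z * partial i G z + G z * partial i F z).
Proof.
move=> FC1 GC1.
have D i z : is_derive z (delta_mx i ord0) (fun z => F z * G z)
    (F z * partial i G z + G z * partial i F z).
  apply: is_deriveM; apply: DeriveDef => //; first exact: (FC1 i).1.
  exact: (GC1 i).1.
have E i : partial i (fun z => F z * G z) =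
    (fun z => F z * partial i G z + G z * partial i F z).
  by apply/funext => z; case: (D i z).
split => // i; split => [z|]; first by case: (D i z).
rewrite E => z; apply: (@cvgD _ _ _ (nbhs z) _ (fun z => F z * partial i G z)).
  apply: (@cvgM _ _ (nbhs z)); first exact: C1_continuous.
  exact: (GC1 i).2.
apply: (@cvgM _ _ (nbhs z)); first exact: C1_continuous.
exact: (FC1 i).2.
Qed.

End products.

Section spherical.
Context {R : realType}.
Variables (n : nat) (g G GG : R -> R) (F : 'cV[R]_n.+1 -> R).
Hypotheses (gG : is_tail g G) (GGG : is_tail G GG) (F_C2 : C2 F).

Local Notation lam := (lebesgue_cV n.+1).
Local Notation Q := half_sqnorm.
Local Notation integ := (fun h : 'cV[R]_n.+1 -> R => lam.-integrable setT (EFin \o h)).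

Hypothesis ig : integ (fun z => g (Q z)).
Hypothesis iFG : integ (fun z => F z * G (Q z)).
Hypothesis iddF : forall i, integ (fun z => partial i (partial i F) z * GG (Q z)).

Let mF : measurable_fun setT F.
Proof. by case: F_C2 => F1 _; apply: continuous_measurable_cV; exact: C1_continuous F1. Qed.

Let mdF i : measurable_fun setT (partial i F).
Proof. by case: F_C2 => F1 _; apply: continuous_measurable_cV; exact: (F1 i).2. Qed.

Let mg : measurable_fun setT (fun z : 'cV[R]_n.+1 => g (Q z)).
Proof. by case: gG => mg _ _ _ _; exact: measurable_half_sqnorm. Qed.

Let mG : measurable_fun setT (fun z : 'cV[R]_n.+1 => G (Q z)).
Proof. by case: gG => _ mG _ _ _; exact: measurable_half_sqnorm. Qed.

Let mz (i : 'I_n.+1) : measurable_fun setT (fun z : 'cV[R]_n.+1 => z i ord0).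
Proof. exact: measurable_entry. Qed.

Let g0 u : 0 <= g u. Proof. by case: gG. Qed.
Let G0 u : 0 <= G u. Proof. by case: gG. Qed.
Let GG0 u : 0 <= GG u. Proof. by case: GGG. Qed.

Let integ_dominated (h k : 'cV[R]_n.+1 -> R) : measurable_fun setT h -> integ k ->
  (forall z, `|h z| <= `|k z|) -> integ h.
Proof.
move=> mh ik hk; apply: le_integrable ik => //; first exact/measurable_EFinP.
by move=> z _; rewrite lee_fin.
Qed.

Let integ_add (h k : 'cV[R]_n.+1 -> R) : integ h -> integ k -> integ (fun z => h z + k z).
Proof. by move=> ih ik; apply: (integrableD measurableT ih ik). Qed.

Let integ_norm (h : 'cV[R]_n.+1 -> R) : integ h -> integ (fun z => `|h z|).
Proof. exact: integrable_abse. Qed.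

Let integ_scale c (h : 'cV[R]_n.+1 -> R) : integ h -> integ (fun z => c * h z).
Proof. by move=> ih; apply: (integrableZl measurableT c ih). Qed.

Let integ_bound (h k : 'cV[R]_n.+1 -> R) : measurable_fun setT h -> integ k ->
  (\int[lam]_z `|h z|%:E <= \int[lam]_z (k z)%:E)%E -> integ h.
Proof.
move=> mh /integrable_fin_num kfin hk; apply/integrableP.
split; first exact/measurable_EFinP.
by apply: le_lt_trans hk _; rewrite ltey_eq kfin.
Qed.

Let i_zdF i : integ (fun z => z i ord0 * partial i F z * G (Q z)).
Proof.
apply: (integ_bound (k := fun z => 9 * (`|F z| * G (Q z)) +
    `|partial i (partial i F) z| * GG (Q z))).
- by do 2 apply: measurable_funM => //.
- apply: integ_add.
    apply: integ_scale; have := integ_norm iFG.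
    by under eq_fun do rewrite normrM (ger0_norm (G0 _)).
  have := integ_norm (iddF i).
  by under eq_fun do rewrite normrM (ger0_norm (GG0 _)).
have := coord_bound2 i gG GGG F_C2.
by under eq_integral do rewrite -[X in _ * X](ger0_norm (G0 _)) -normrM.
Qed.

Let i_z2F i : integ (fun z => z i ord0 ^+ 2 * F z * g (Q z)).
Proof.
apply: (integ_bound (k := fun z => `|F z * G (Q z)| +
    `|z i ord0 * partial i F z * G (Q z)|)).
- apply: measurable_funM => //; apply: measurable_funM => //.
  exact: (@measurableT_comp _ _ _ _ _ _ (fun x : R => x ^+ 2)%R).
- by apply: integ_add; apply: integ_norm.
have := coord_bound1 i gG F_C2.1.
under eq_integral do rewrite -[X in _ * X](ger0_norm (g0 _)) -normrM.
by under [leRHS]eq_integral do rewrite mulrDl -[X in _ * X + _](ger0_norm (G0 _))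
  -[X in _ + _ * X](ger0_norm (G0 _)) -!normrM.
Qed.

(* Near the origin [F] is bounded by continuity; elsewhere some [z i ord0 ^+ 2] is
   bounded below and [i_z2F] applies. *)
Let i_F : integ (fun z => F z * g (Q z)).
Proof.
have cF : continuous F by apply: C1_continuous; case: F_C2.
have [e e0 eF] : exists2 e : R, 0 < e & forall z, `|z| < e -> `|F z| <= `|F 0| + 1.
  have /cvgrPdist_lt/(_ _ ltr01)/nbhs_ballP[e e0 H] := cF 0.
  exists e => // z ze; have := H z; rewrite -ball_normE/= sub0r normrN => /(_ ze) Fz.
  by rewrite -lerBlDl (le_trans (lerB_dist _ _))// distrC ltW.
pose k z := (`|F 0| + 1) * g (Q z) +
  \sum_i e ^- 2 * `|z i ord0 ^+ 2 * F z * g (Q z)|.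
apply: (integ_dominated (k := k)).
- exact: measurable_funM.
- apply: integ_add; first exact: integ_scale.
  by apply: (integrable_lincomb _ (fun=> e ^- 2) _).1 => i; exact: integ_norm.
move=> z; rewrite [leRHS]ger0_norm; last first.
  rewrite addr_ge0 ?mulr_ge0 ?addr_ge0 ?sumr_ge0// => i _.
  by rewrite mulr_ge0// invr_ge0 exprn_ge0// ltW.
rewrite normrM (ger0_norm (g0 _)) /k.
have [ze|ze] := ltP `|z| e.
  apply: ler_wpDr; last by rewrite ler_wpM2r// eF.
  by apply: sumr_ge0 => i _; rewrite mulr_ge0// invr_ge0 exprn_ge0// ltW.
have [i ei] : exists i, e <= `|z i ord0|.
  have : mx_norm z != 0 by rewrite gt_eqF// (lt_le_trans e0 ze).
  move=> /mx_norm_neq0[[i j] /= E]; exists i.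
  by rewrite (ord1 j) in E; rewrite -E.
apply: ler_wpDl; first by rewrite mulr_ge0// addr_ge0.
rewrite (bigD1 i)//=; apply: ler_wpDr.
  by apply: sumr_ge0 => j _; rewrite mulr_ge0// invr_ge0 exprn_ge0// ltW.
have ez : 1 <= e ^- 2 * `|z i ord0| ^+ 2.
  by rewrite mulrC ler_pdivlMr ?exprn_gt0// mul1r lerXn2r// nnegrE ltW.
rewrite (normrM _ (g _)) (normrM _ (F z)) (ger0_norm (g0 _)) normrX -mulrA.
by rewrite [leRHS]mulrA ler_peMl// mulr_ge0.
Qed.

Let i_zF : integ (fun z => z ord0 ord0 * F z * g (Q z)).
Proof.
pose k z := F z * g (Q z); pose l (z : 'cV[R]_n.+1) := z ord0 ord0 ^+ 2 * F z * g (Q z).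
apply: (integ_dominated (k := fun z => `|k z| + `|l z|)).
- by apply: measurable_funM => //; exact: measurable_funM.
- by apply: integ_add; apply: integ_norm; [exact: i_F|exact: i_z2F].
move=> z; rewrite [leRHS]ger0_norm ?addr_ge0//.
have -> : l z = z ord0 ord0 ^+ 2 * k z by rewrite /l /k mulrA.
have -> : z ord0 ord0 * F z * g (Q z) = z ord0 ord0 * k z by rewrite /k mulrA.
move: (k z) (z ord0 ord0) => y t; rewrite (normrM (t ^+ 2)) normrX (normrM t).
rewrite -[X in X + _]mul1r -mulrDl ler_wpM2r//.
by have := normr_ge0 t; move: `|t| => s; nra.
Qed.

Hypothesis idF : integ (fun z => partial ord0 F z * G (Q z)).

Lemma spherical_moment1 :
  \int[lam]_z (z ord0 ord0 * F z * g (Q z)) = \int[lam]_z (partial ord0 F z * G (Q z)).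
Proof. by rewrite /Rintegral (space_by_parts gG F_C2.1 i_zF idF). Qed.

Lemma spherical_moment2 :
  \int[lam]_z (z ord0 ord0 ^+ 2 * F z * g (Q z)) =
  \int[lam]_z (F z * G (Q z)) + \int[lam]_z (partial ord0 (partial ord0 F) z * GG (Q z)).
Proof.
have [F1 F2] := F_C2; have [z1 dz] := C1_coord (R := R) (@ord0 n).
have [zF1 dzF] := C1_mul z1 F1.
have dzF0 : partial ord0 (fun z : 'cV[R]_n.+1 => z ord0 ord0 * F z) =
    (fun z => z ord0 ord0 * partial ord0 F z + F z).
  by rewrite dzF dz; apply/funext => z /=; rewrite ?eqxx mulr1.
have := space_by_parts gG zF1.
rewrite dzF0.
have -> : (fun z : 'cV[R]_n.+1 => (z ord0 ord0 * (z ord0 ord0 * F z) * g (Q z))%:E) =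
   EFin \o (fun z : 'cV[R]_n.+1 => z ord0 ord0 ^+ 2 * F z * g (Q z)).
  by apply/funext => z /=; rewrite mulrA -expr2.
have -> : (fun z : 'cV[R]_n.+1 => ((z ord0 ord0 * partial ord0 F z + F z) * G (Q z))%:E) =
   EFin \o (fun z : 'cV[R]_n.+1 => z ord0 ord0 * partial ord0 F z * G (Q z) + F z * G (Q z)).
  by apply/funext => z /=; rewrite mulrDl.
move=> /(_ (i_z2F ord0) (integ_add (i_zdF ord0) iFG)) H.
transitivity (\int[lam]_z (z ord0 ord0 * partial ord0 F z * G (Q z) + F z * G (Q z))).
  by rewrite /Rintegral; congr fine.
rewrite RintegralD; [|by []|exact: i_zdF|exact: iFG].
rewrite addrC; congr (_ + _).
by rewrite /Rintegral (space_by_parts GGG (F2 ord0) (i_zdF ord0) (iddF ord0)).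
Qed.

(** Integrability of the three terms into which the square of an affine function
    of the first coordinate expands. *)
Lemma spherical_integrable :
  [/\ integ (fun z => F z * g (Q z)), integ (fun z => z ord0 ord0 * F z * g (Q z)) &
      integ (fun z => z ord0 ord0 ^+ 2 * F z * g (Q z))].
Proof. by split. Qed.

End spherical.

(** * The theorem *)

Lemma expectation_elliptical_fin (R : realType) n d (T : measurableType d)
    (P : probability T R) (X : {RV P >-> 'cV[R]_n}) (mu : 'cV[R]_n) (S A : 'M[R]_n)
    (g : R -> R) (k : 'cV[R]_n -> R) :
  density_generator n g -> cholesky_factor S A -> elliptical X mu S g ->
  measurable_fun setT k ->
  (lebesgue_cV n).-integrable setT
    (EFin \o (fun z => k (A *m z + mu) * on_half_line g (half_sqnorm z))) ->
  ('E_P[fun w => k (X w)] = (normalizing_constant n g *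
    \int[lebesgue_cV n]_z (k (A *m z + mu) * on_half_line g (half_sqnorm z)))%:E)%E.
Proof.
move=> gg SA X_ell mk ik; rewrite (expectation_elliptical gg SA X_ell mk).
rewrite -RintegralZl// -Rintegral_EFin; last exact: (integrableZl measurableT _ ik).
by apply: eq_integral => z _; congr EFin; rewrite mulrCA.
Qed.

Theorem theorem1 (R : realType) (n : nat)
    (d ds dss : measure_display)
    (T : measurableType d) (Ts : measurableType ds) (Tss : measurableType dss)
    (P : probability T R) (Ps : probability Ts R) (Pss : probability Tss R)
    (X : {RV P >-> 'cV[R]_n.+1})
    (Xs : {RV Ps >-> 'cV[R]_n.+1})
    (Xss : {RV Pss >-> 'cV[R]_n.+1})
    (mu : 'cV[R]_n.+1) (Sigma A : 'M[R]_n.+1)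
    (g : R -> R) (f : 'cV[R]_n.+1 -> R)
    (gen_g : density_generator n.+1 g)
    (gen_G : density_generator n.+1 (cumulative_generator g))
    (gen_GG : density_generator n.+1 (cumulative_generator (cumulative_generator g)))
    (Sigma_posdef : posdef Sigma)
    (A_cholesky : cholesky_factor Sigma A)
    (X_ell : elliptical X mu Sigma g)
    (Xs_ell : elliptical Xs mu Sigma (cumulative_generator g))
    (Xss_ell : elliptical Xss mu Sigma (cumulative_generator (cumulative_generator g)))
    (X_mean : forall i,
      P.-integrable setT (fun w => (X w i ord0)%:E) /\
      ('E_P[fun w => X w i ord0] = (mu i ord0)%:E)%E)
    (f_C2 : C2 f)
    (int_hess : forall i j,
      Pss.-integrable setT (fun w => (partial i (partial j f) (Xss w))%:E))
    (int_grad : forall i,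
      Ps.-integrable setT (fun w => (partial i f (Xs w))%:E))
    (int_f : Ps.-integrable setT (fun w => (f (Xs w))%:E))
    (lim_f : vanishes_first (fun x =>
      x ord0 ord0 * f (A *m x + mu) *
        cumulative_generator g (2^-1 * (x^T *m x) ord0 ord0)))
    (lim_grad : vanishes_first (fun x =>
      partial ord0 (fun y => f (A *m y + mu)) x *
        cumulative_generator (cumulative_generator g)
          (2^-1 * (x^T *m x) ord0 ord0))) :
  let c := normalizing_constant n.+1 g in
  let cs := normalizing_constant n.+1 (cumulative_generator g) in
  let css := normalizing_constant n.+1
               (cumulative_generator (cumulative_generator g)) in
  let bs := c / cs in
  let bss := c / css in
  ('E_P[fun w => (X w ord0 ord0 ^+ 2 * f (X w))%R] =
     (Sigma ord0 ord0 * bs)%:E * 'E_Ps[fun w => f (Xs w)]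
   + bss%:E * (\sum_(i < n.+1) \sum_(j < n.+1)
       (Sigma i ord0 * Sigma j ord0)%:E
         * 'E_Pss[fun w => partial i (partial j f) (Xss w)])
   + (2 * mu ord0 ord0 * bs)%:E * (\sum_(i < n.+1)
       (Sigma i ord0)%:E * 'E_Ps[fun w => partial i f (Xs w)])
   + (mu ord0 ord0 ^+ 2)%:E * 'E_P[fun w => f (X w)])%E.
Proof.
move=> c cs css bs bss.
set g0 := on_half_line g.
set G0 := on_half_line (cumulative_generator g).
set GG0 := on_half_line (cumulative_generator (cumulative_generator g)).
pose lam : {sigma_finite_measure set 'cV[R]_n.+1 -> \bar R} := lebesgue_cV n.+1.
have gG : is_tail g0 G0 := generator_is_tail gen_g gen_G.
have GGG : is_tail G0 GG0 := generator_is_tail gen_G gen_GG.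
have [f1 f2] := f_C2.
have mf := continuous_measurable_cV (C1_continuous f1).
have mdf i := continuous_measurable_cV (f1 i).2.
have mddf i j := continuous_measurable_cV (f2 j i).2.
have cs0 : cs != 0 := normalizing_constant_neq0 gen_G A_cholesky Xs_ell.
have css0 : css != 0 := normalizing_constant_neq0 gen_GG A_cholesky Xss_ell.
pose aff (z : 'cV[R]_n.+1) := A *m z + mu.
pose F (z : 'cV[R]_n.+1) := f (aff z).
have F_C2 : C2 F := C2_affine A mu f_C2.
have iJ0 := integrable_elliptical gen_G A_cholesky Xs_ell mf int_f.
have iJ i := integrable_elliptical gen_G A_cholesky Xs_ell (mdf i) (int_grad i).
have iK i j := integrable_elliptical gen_GG A_cholesky Xss_ell (mddf i j) (int_hess i j).
have ig : lam.-integrable setT (EFin \o (fun z => g0 (half_sqnorm z))).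
  have := integrable_elliptical gen_g A_cholesky X_ell (k := cst 1) (measurable_cst _)
    (finite_measure_integrable_cst P 1 measurableT).
  by under eq_fun do rewrite mul1r.
pose J0 := \int[lam]_z (F z * G0 (half_sqnorm z)).
pose J i := \int[lam]_z (partial i f (aff z) * G0 (half_sqnorm z)).
pose K i j := \int[lam]_z (partial i (partial j f) (aff z) * GG0 (half_sqnorm z)).
have [idF EdF] : lam.-integrable setT
      (EFin \o (fun z => partial ord0 F z * G0 (half_sqnorm z))) /\
    \int[lam]_z (partial ord0 F z * G0 (half_sqnorm z)) = \sum_k A k ord0 * J k.
  have -> : (fun z => partial ord0 F z * G0 (half_sqnorm z)) =
      (fun z => \sum_k A k ord0 * (partial k f (aff z) * G0 (half_sqnorm z))).
    apply/funext => z; rewrite partial_affine// mulr_suml.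
    by apply: eq_bigr => k _; rewrite mulrA.
  exact: integrable_lincomb.
have ddFP i : lam.-integrable setT
      (EFin \o (fun z => partial i (partial i F) z * GG0 (half_sqnorm z))) /\
    \int[lam]_z (partial i (partial i F) z * GG0 (half_sqnorm z)) =
      \sum_k \sum_l A k i * A l i * K l k.
  pose h (p : 'I_n.+1 * 'I_n.+1) (z : 'cV[R]_n.+1) :=
    partial p.2 (partial p.1 f) (aff z) * GG0 (half_sqnorm z).
  have -> : (fun z => partial i (partial i F) z * GG0 (half_sqnorm z)) =
      (fun z => \sum_p A p.1 i * A p.2 i * h p z).
    apply/funext => z; rewrite partial2_affine// pair_big/= mulr_suml.
    by apply: eq_bigr => p _; rewrite mulrA.
  have [ih ->] := @integrable_lincomb _ _ _ lam _ (index_enum _)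
    (fun p => A p.1 i * A p.2 i) h (fun p => iK p.2 p.1).
  by split => //; rewrite pair_big.
have [i0 i1 i2] := spherical_integrable gG GGG F_C2 ig iJ0 (fun i => (ddFP i).1).
have E1 := spherical_moment1 gG GGG F_C2 ig iJ0 (fun i => (ddFP i).1) idF.
have E2 := spherical_moment2 gG GGG F_C2 iJ0 (fun i => (ddFP i).1).
rewrite EdF in E1; rewrite (ddFP ord0).2 -/J0 in E2.
pose a := A ord0 ord0; pose m := mu ord0 ord0.
have [trA _ AAT] := A_cholesky.
have A0 k : k != ord0 -> A ord0 k = 0.
  by move=> k0; move/is_trig_mxP : trA; apply; rewrite lt0n.
have SE i : Sigma i ord0 = A i ord0 * a.
  rewrite -AAT mxE (bigD1 ord0)//= big1 ?addr0 ?mxE// => k k0.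
  by rewrite mxE A0 ?mulr0.
have aff0 z : aff z ord0 ord0 = a * z ord0 ord0 + m.
  rewrite !mxE (bigD1 ord0)//= big1 ?addr0// => k k0.
  by rewrite A0 ?mul0r.
set I0 := \int[lam]_z (F z * g0 (half_sqnorm z)).
have EX : ('E_P[fun w => (X w ord0 ord0 ^+ 2 * f (X w))%R] =
    (c * (a ^+ 2 * (J0 + \sum_k \sum_l A k ord0 * A l ord0 * K l k) +
      2 * a * m * (\sum_k A k ord0 * J k) + m ^+ 2 * I0))%:E)%E.
  pose k (x : 'cV[R]_n.+1) := x ord0 ord0 ^+ 2 * f x.
  have mk : measurable_fun setT k.
    apply: measurable_funM => //.
    apply: (@measurableT_comp _ _ _ _ _ _ (fun x : R => x ^+ 2)) => //.
    exact: measurable_entry.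
  have kE : (fun z => k (aff z) * g0 (half_sqnorm z)) = (fun z =>
      a ^+ 2 * (z ord0 ord0 ^+ 2 * F z * g0 (half_sqnorm z)) +
      (2 * a * m * (z ord0 ord0 * F z * g0 (half_sqnorm z)) +
       m ^+ 2 * (F z * g0 (half_sqnorm z)))).
    by apply/funext => z; rewrite /k aff0 /F; ring.
  have j2 := integrableZl measurableT (a ^+ 2) i2.
  have j1 := integrableZl measurableT (2 * a * m) i1.
  have j0 := integrableZl measurableT (m ^+ 2) i0.
  have j01 := integrableD measurableT j1 j0.
  have jk : lam.-integrable setT (EFin \o (fun z => k (aff z) * g0 (half_sqnorm z))).
    by rewrite kE; exact: (integrableD measurableT j2 j01).
  rewrite (expectation_elliptical_fin gen_g A_cholesky X_ell mk jk); congr (_ * _)%:E.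
  rewrite -/lam kE RintegralD; [|by []|exact: j2|exact: j01].
  rewrite RintegralD; [|by []|exact: j1|exact: j0].
  rewrite (RintegralZl _ measurableT i2) (RintegralZl _ measurableT i1).
  rewrite (RintegralZl _ measurableT i0) E1 E2.
  by rewrite addrA.
have Ef := expectation_elliptical_fin gen_g A_cholesky X_ell mf i0.
have EJ0 := expectation_elliptical_fin gen_G A_cholesky Xs_ell mf iJ0.
have EJ i := expectation_elliptical_fin gen_G A_cholesky Xs_ell (mdf i) (iJ i).
have EK i j := expectation_elliptical_fin gen_GG A_cholesky Xss_ell (mddf i j) (iK i j).
rewrite EX Ef EJ0.
under [X in (_ = _ + bss%:E * X + _ + _)%E]eq_bigr => i _.
  under eq_bigr => j _ do rewrite EK -EFinM.
  rewrite sumEFin.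
  over.
under [X in (_ = _ + _ * X + _)%E]eq_bigr => i _ do rewrite EJ -EFinM.
rewrite !sumEFin -!EFinM -!EFinD; congr EFin.
have EJS : \sum_i Sigma i ord0 * (cs * J i) = a * cs * \sum_k A k ord0 * J k.
  by rewrite mulr_sumr; apply: eq_bigr => i _; rewrite SE; ring.
have EKS : \sum_i \sum_j Sigma i ord0 * Sigma j ord0 * (css * K i j) =
    a ^+ 2 * css * \sum_k \sum_l A k ord0 * A l ord0 * K l k.
  rewrite exchange_big mulr_sumr; apply: eq_bigr => j _.
  by rewrite mulr_sumr; apply: eq_bigr => i _; rewrite !SE; ring.
rewrite -/lam -/cs -/css -/c [X in _ = _ + bss * X + _ + _]EKS [X in _ = _ + _ * X + _]EJS.
rewrite -/I0 -/J0 SE /bs /bss -/a -/m.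
by field; rewrite cs0 css0.
Qed.
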